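(* Let $H$ be a $d$-dimensional semisimple Hopf algebra over $\mathbb{C}$. Then for all $0\le i,j\le m-1$, $$\sum_{k=0}^{n-1}\xi_{ki}\overline{\xi_{kj}}=\delta_{ij}\frac{d\,\dim(f_iR(H))}{\dim(f_iH^* )}.$$
   Context: $\Lambda\in H$ is the (two-sided) integral of $H$ and $\lambda\in H^*$ the integral of $H^*$ with $\langle\lambda,\Lambda\rangle=1$. For $h\in H$, $p\in H^*$, $h\leftharpoonup p=\sum\langle p,h_1\rangle h_2$. $\chi_0=\varepsilon,\dots,\chi_{n-1}$ are the irreducible characters of $H$; $R(H)\subset H^*$ is their span. $F_0=\frac1d\lambda,\dots,F_{m-1}$ are the central primitive idempotents of $R(H)$; for each $j$, $f_j\in R(H)$ is a primitive idempotent with $f_jF_j=f_j$. $\eta_j=\frac{1}{\dim(f_jH^* )}(\Lambda\leftharpoonup dF_j)$ and $\xi_{ij}=\langle\chi_i,\eta_j\rangle$ (the generalized character table). *)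

(* Defs.v *)
(* A finite-dimensional Hopf algebra over the complex numbers
   C := R[i] (R : realType, i.e. the real numbers) is given concretely by its
   structure constants with respect to a basis e_0, ..., e_(d-1) of H.
   Elements of H are row vectors 'rV[C]_d (coordinates in the basis e),
   elements of H^* are also row vectors 'rV[C]_d (coordinates in the dual
   basis dual to e), so that <p, h> = \sum_a p_a h_a. *)
From mathcomp Require Import all_boot all_algebra.
From mathcomp Require Import reals.
From mathcomp.real_closed Require Import complex.
Set Implicit Arguments. Unset Strict Implicit. Unset Printing Implicit Defensive.
Import GRing.Theory Num.Theory.
Local Open Scope ring_scope.

Record hopf_data (R : realType) (d : nat) := HopfData {
  (* e_a e_b = \sum_c hmu a b c e_c *)
  hmu : 'I_d -> 'I_d -> 'I_d -> R[i];
  hone : 'rV[R[i]]_d;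
  (* Delta e_a = \sum_(b,c) hDelta a b c e_b (x) e_c *)
  hDelta : 'I_d -> 'I_d -> 'I_d -> R[i];
  (* counit: eps(e_a) = heps a; heps is also the counit as an element of H^* *)
  heps : 'rV[R[i]]_d;
  (* antipode: S e_a = \sum_b hS a b e_b *)
  hS : 'I_d -> 'I_d -> R[i]
}.

Section HopfDefs.
Variables (R : realType) (d : nat) (H : hopf_data R d).
Local Notation C := (R[i]).
Local Notation mu := (hmu H).
Local Notation D := (hDelta H).
Local Notation one := (hone H).
Local Notation eps := (heps H).
Local Notation S := (hS H).

Definition hbasis (a : 'I_d) : 'rV[C]_d := delta_mx 0 a.

Definition hmul (x y : 'rV[C]_d) : 'rV[C]_d :=
  \row_c \sum_a \sum_b x 0 a * y 0 b * mu a b c.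

Definition hpair (p h : 'rV[C]_d) : C := \sum_a p 0 a * h 0 a.

(* multiplication of H^* (convolution): (pq)(h) = \sum <p, h_1> <q, h_2> *)
Definition dmul (p q : 'rV[C]_d) : 'rV[C]_d :=
  \row_c \sum_a \sum_b p 0 a * q 0 b * D c a b.

(* h <- p = \sum <p, h_1> h_2 *)
Definition hlharp (h p : 'rV[C]_d) : 'rV[C]_d :=
  \row_c \sum_a \sum_b h 0 a * p 0 b * D a b c.

Definition is_hopf_algebra : Prop :=
  (forall x y z, hmul (hmul x y) z = hmul x (hmul y z)) /\
  (forall x, hmul one x = x /\ hmul x one = x) /\
  (* coassociativity: (Delta (x) id) Delta = (id (x) Delta) Delta *)
  (forall a b c e, \sum_x D a x e * D x b c = \sum_x D a b x * D x c e) /\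
  (* counit: (eps (x) id) Delta = id = (id (x) eps) Delta *)
  (forall a c, \sum_b eps 0 b * D a b c = (a == c)%:R) /\
  (forall a b, \sum_c D a b c * eps 0 c = (a == b)%:R) /\
  (* Delta is a unital algebra map H -> H (x) H *)
  (forall a b x y, \sum_c mu a b c * D c x y =
      \sum_p \sum_q \sum_r \sum_s D a p q * D b r s * mu p r x * mu q s y) /\
  (forall x y, \sum_a one 0 a * D a x y = one 0 x * one 0 y) /\
  (forall a b, \sum_c mu a b c * eps 0 c = eps 0 a * eps 0 b) /\
  hpair eps one = 1 /\
  (* antipode: m (S (x) id) Delta = eta eps = m (id (x) S) Delta *)
  (forall a c, \sum_p \sum_q \sum_r D a p q * S p r * mu r q c = eps 0 a * one 0 c) /\
  (forall a c, \sum_p \sum_q \sum_r D a p q * S q r * mu p r c = eps 0 a * one 0 c).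

Definition left_ideal (U : 'M[C]_d) : Prop :=
  forall h u : 'rV[C]_d, (u <= U)%MS -> (hmul h u <= U)%MS.

(* H is semisimple (as an algebra): every left ideal is a direct summand of
   the left regular module H, i.e. has a complementary left ideal *)
Definition semisimple : Prop :=
  forall U, left_ideal U ->
  exists2 V, left_ideal V & ((U + V :=: 1%:M)%MS /\ (U :&: V <= (0 : 'M[C]_d))%MS).

Definition is_integral (L : 'rV[C]_d) : Prop :=
  forall h, hmul h L = hpair eps h *: L /\ hmul L h = hpair eps h *: L.
Definition is_dual_integral (l : 'rV[C]_d) : Prop :=
  forall p, dmul p l = hpair p one *: l /\ dmul l p = hpair p one *: l.

(* finite-dimensional representations of H: algebra maps H -> M_r(C),
   given on the basis *)
Definition is_rep (r : nat) (rho : 'I_d -> 'M[C]_r) : Prop :=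
  (forall a b, rho a *m rho b = \sum_c mu a b c *: rho c) /\
  \sum_a one 0 a *: rho a = 1%:M.

(* irreducible: nonzero and no invariant subspace other than 0 and C^r
   (subspaces of column vectors C^r are given as U^T for U a row space) *)
Definition irr_rep (r : nat) (rho : 'I_d -> 'M[C]_r) : Prop :=
  [/\ is_rep rho, (0 < r)%N &
      forall U : 'M[C]_r, (forall a, stablemx U (rho a)^T) ->
        (U == 0) || row_full U].

Definition character (r : nat) (rho : 'I_d -> 'M[C]_r) : 'rV[C]_d :=
  \row_a \tr (rho a).

Definition irr_character (chi : 'rV[C]_d) : Prop :=
  exists r (rho : 'I_d -> 'M[C]_r), irr_rep rho /\ chi = character rho.

(* R(H) = span of the irreducible characters chi_0..chi_(n-1) *)
Definition RH (n : nat) (chi : 'I_n -> 'rV[C]_d) : 'M[C]_(n, d) :=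
  \matrix_k chi k.

Definition in_RH n (chi : 'I_n -> 'rV[C]_d) (p : 'rV[C]_d) : Prop :=
  (p <= RH chi)%MS.

Definition idem (e : 'rV[C]_d) : Prop := dmul e e = e.

Definition prim_idem n (chi : 'I_n -> 'rV[C]_d) (e : 'rV[C]_d) : Prop :=
  [/\ in_RH chi e, idem e, e != 0 &
      forall e1 e2, in_RH chi e1 -> in_RH chi e2 -> idem e1 -> idem e2 ->
        dmul e1 e2 = 0 -> dmul e2 e1 = 0 -> e = e1 + e2 -> e1 = 0 \/ e2 = 0].

Definition central_RH n (chi : 'I_n -> 'rV[C]_d) (e : 'rV[C]_d) : Prop :=
  forall p, in_RH chi p -> dmul e p = dmul p e.

Definition central_prim_idem n (chi : 'I_n -> 'rV[C]_d) (e : 'rV[C]_d) : Prop :=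
  [/\ in_RH chi e, central_RH chi e, idem e, e != 0 &
      forall e1 e2, in_RH chi e1 -> in_RH chi e2 ->
        central_RH chi e1 -> central_RH chi e2 -> idem e1 -> idem e2 ->
        dmul e1 e2 = 0 -> e = e1 + e2 -> e1 = 0 \/ e2 = 0].

Definition dim_fHs (f : 'rV[C]_d) : nat :=
  \rank (\matrix_(a < d) dmul f (hbasis a)).
Definition dim_fRH n (chi : 'I_n -> 'rV[C]_d) (f : 'rV[C]_d) : nat :=
  \rank (\matrix_(k < n) dmul f (chi k)).

Definition eta (L F f : 'rV[C]_d) : 'rV[C]_d :=
  (dim_fHs f)%:R^-1 *: hlharp L (d%:R *: F).

End HopfDefs.

(* Main.v *)
From HB Require Import structures.
Require Import Defs.
From mathcomp Require Import all_boot all_algebra.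
From mathcomp Require Import boolp reals.
From mathcomp.real_closed Require Import complex mxtens.
From mathcomp Require Import ring.
Set Implicit Arguments. Unset Strict Implicit. Unset Printing Implicit Defensive.
Import GRing.Theory Num.Theory.
Local Open Scope ring_scope.

(* Write <p, L> for the value at the integral L of p in H^*. It is 1/d times the
   trace of left multiplication by p on H^*, hence a trace form on R(H), and for
   it the bases (chi_k) and (S chi_k) of R(H) are dual (Schur's lemma applied to
   the averaging operator X |-> rho(L_1) X sigma(S L_2)). Structure constants of
   R(H) are natural numbers, so antilinear extension of chi_k |-> S chi_k is a
   positive involution, which fixes every F_j. By Parseval the sum over k is
   therefore delta_ij <F_i, L> up to the factors d / dim (f_j H^* ). A Casimir
   computation in R(H), using f R(H) f = C f and Z(R(H)) F = C F, gives
   <F_i, L> = dim (f_i R(H)) <f_i, L>, and d <f_i, L> = dim (f_i H^* ).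

   That lambda / d is one of the F_j already says that lambda lies in R(H), so
   lambda is a trace form on H. The Frobenius formulas S(h) = L_1 lambda(h L_2)
   and h = S(L_1) lambda(L_2 h) then give S^2 = 1 directly. *)

(** * Traces and primitive idempotents of matrix algebras *)

Lemma mxtrace_mul_base (K : fieldType) d (A : 'M[K]_d) :
  \tr A = \tr (row_base A *m col_base A).
Proof. by rewrite -{1}(mulmx_base A) mxtrace_mulC. Qed.

(** [A] cancels on the left and [B] on the right, so [A (BA) B = A B] leaves [BA = 1]. *)
Lemma mulmx_idem_base (K : fieldType) d r (A : 'M[K]_(d, r)) (B : 'M[K]_(r, d)) :
  row_full A -> row_free B -> (A *m B) *m (A *m B) = A *m B -> B *m A = 1%:M.
Proof.
move=> fA fB AB; apply: (row_free_inj fB); apply: (row_full_inj fA).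
by rewrite /= mul1mx -[RHS]AB !mulmxA.
Qed.

Lemma mxtrace_idem (K : fieldType) d (A : 'M[K]_d) :
  A *m A = A -> \tr A = (\rank A)%:R.
Proof.
move=> AA; rewrite mxtrace_mul_base.
rewrite mulmx_idem_base ?mxtrace1 ?col_base_full ?row_base_free //.
by rewrite !mulmx_base.
Qed.

(** Induction on the size. Factors of an invertible [A] cancel down to [1 = 0]. A singular [A = XY],
    factored through its rank, has the trace of the smaller matrix [YX], which is nilpotent since
    its power [k.+1] is [Y A^k X]. *)
Lemma mxtrace_nilpotent (K : fieldType) d (A : 'M[K]_d) k :
  A ^+ k = 0 -> \tr A = 0.
Proof.
elim: d {-2}d (leqnn d) A k => [|N IH] d dN A k Ak.
  by move: dN A {Ak}; case: d => // _ A; rewrite [A]flatmx0 mxtrace0.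
have [fA|nfA] := boolP (row_free A).
  elim: k Ak => [|k IHk]; first by move=> E; rewrite -[A]mulmx1 (E : 1%:M = 0) mulmx0 mxtrace0.
  rewrite exprSr => Ak; apply: IHk; apply: (row_free_inj fA).
  by rewrite /= mul0mx.
rewrite mxtrace_mul_base; apply: (IH _ _ _ k.+1).
  by rewrite -ltnS (leq_trans _ dN) // ltn_neqAle rank_leq_row andbT.
have -> : (row_base A *m col_base A) ^+ k.+1 = row_base A *m A ^+ k *m col_base A.
  elim: k {Ak} => [|k IHk]; first by rewrite expr1 expr0 -[1]/(1%:M) mulmx1.
  rewrite exprSr IHk -[_ * _]/(_ *m _) [in RHS]exprSr -[A ^+ k * A]/(_ *m _).
  transitivity (row_base A *m (A ^+ k *m (col_base A *m row_base A)) *m col_base A).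
    by rewrite !mulmxA.
  by rewrite mulmx_base.
by rewrite Ak mulmx0 mul0mx.
Qed.

(* Splits off, as an idempotent polynomial in [x], the part of [p] prime to one
   of its roots, until only one root is left. *)
Lemma fitting (C : closedFieldType) d (e x : 'M[C]_d.+1) (p : {poly C}) :
  e != 0 -> e * e = e -> GRing.comm e x ->
  (forall q, let y := e * horner_mx x q in y * y = y -> y = 0 \/ y = e) ->
  p != 0 -> e * horner_mx x p = 0 ->
  exists a k, e * (x - a%:M) ^+ k = 0.
Proof.
move=> e0 ee ex trivial_idem; have [N] := ubnP (size p).
elim: N p => // N IH p; rewrite ltnS => pN p0 ep.
have ec q : GRing.comm e (horner_mx x q) by exact: comm_mx_horner.
have [/size_poly1P[c c0 pc]|] := boolP (size p == 1).
  case/eqP: e0; move: ep; rewrite pc horner_mx_C -scalemx1 -scalerAr mulr1.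
  by move/eqP; rewrite scaler_eq0 (negPf c0) => /eqP.
case/closed_rootP => a pa.
have [k [q]] := multiplicity_XsubC p a; rewrite p0 /= => qa pE.
(* As [r q + s (X - a)^k = 1], the polynomial [r q] is idempotent modulo [p]. If its value under [e]
   is 0, then [q] can replace [p]; if it is [e], then [e] kills [(x - a)^k]. *)
have /Bezout_eq1_coprimepP[[r s] /= rs] : coprimep q (('X - a%:P) ^+ k).
  by rewrite coprimep_expr // coprimep_XsubC.
have hX : horner_mx x ('X - a%:P) = x - a%:M.
  by rewrite rmorphB /= horner_mx_X horner_mx_C.
have [] := trivial_idem (r * q).
- have E : (r * q) * (r * q) = r * q - r * s * p.
    by rewrite pE -[X in X - _](mulr1 (r * q)) -rs; ring.
  rewrite /= mulrA -(mulrA e _ e) -ec mulrA ee -mulrA -rmorphM E rmorphB mulrBr.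
  by rewrite [X in _ - e * X]rmorphM /= (mulrA e) -(mulrA e) comm_horner_mx2 mulrA ep mul0r subr0.
- move=> y0.
  have q0 : q != 0 by apply: contraNneq p0 => q0; rewrite pE q0 mul0r.
  have k0 : (0 < k)%N.
    by case: k pE {rs} => // pE; case/negP: qa; move: pa; rewrite pE expr0 mulr1.
  apply: (IH q) => //.
    apply: leq_trans pN; rewrite pE size_Mmonic ?monic_exp ?monicXsubC //.
    by rewrite size_exp_XsubC addnS /= -{1}[size q]addn0 ltn_add2l.
  have -> : q = q * (r * q) + s * p by rewrite -[LHS]mulr1 -rs mulrDr pE !mulrA [s * q]mulrC.
  rewrite rmorphD mulrDr rmorphM /= mulrA ec -mulrA y0 mulr0 add0r.
  by rewrite rmorphM /= comm_horner_mx2 mulrA ep mul0r.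
- move=> y1; exists a, k; rewrite -y1 -mulrA -hX -rmorphXn -rmorphM.
  have -> : r * q * ('X - a%:P) ^+ k = r * p by rewrite pE mulrA.
  by rewrite rmorphM /= comm_horner_mx2 mulrA ep mul0r.
Qed.

Lemma primitive_idem_nilpotent (C : closedFieldType) d (e x : 'M[C]_d.+1) :
  e != 0 -> e * e = e -> e * x = x -> x * e = x ->
  (forall q, let y := e * horner_mx x q in y * y = y -> y = 0 \/ y = e) ->
  exists a k, (x - a *: e) ^+ k = 0.
Proof.
move=> e0 ee ex xe trivial_idem.
have cex : GRing.comm e x by rewrite /GRing.comm ex xe.
have [||a [k ek]] := fitting e0 ee cex trivial_idem (p := char_poly x).
- by rewrite monic_neq0 ?char_poly_monic.
- by rewrite Cayley_Hamilton mulr0.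
(* The successor covers [k = 0], where [e ^+ k] is 1 instead of [e]. *)
exists a, k.+1.
have -> : x - a *: e = e * (x - a%:M) by rewrite mulrBr ex -scalemx1 -scalerAr mulr1.
rewrite exprMn_comm; last by apply: commrB => //; apply: comm_mx_scalar.
have -> : e ^+ k.+1 = e by elim: k {ek} => // k IH; rewrite exprS IH.
by rewrite exprSr mulrA ek mul0r.
Qed.

(** * Subalgebras with dual bases for the normalized trace *)

Section DualBases.
Variables (C : numClosedFieldType) (d n : nat) (u v : 'I_n -> 'M[C]_d.+1).

Definition ntr (x : 'M[C]_d.+1) : C := \tr x / d.+1%:R.

Definition inspan (x : 'M[C]_d.+1) : Prop :=
  exists a : 'I_n -> C, x = \sum_k a k *: u k.

Definition commspan (x : 'M[C]_d.+1) : Prop :=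
  forall y, inspan y -> x * y = y * x.

(** Minimality is tested on idempotents [g] below [e]; the decomposition behind it is
    [e = g + (e - g)]. *)
Definition prim_central (e : 'M[C]_d.+1) : Prop :=
  [/\ inspan e, commspan e, e * e = e, e != 0 &
      forall g, inspan g -> commspan g -> g * g = g -> e * g = g ->
        g = 0 \/ g = e].

Definition prim (e : 'M[C]_d.+1) : Prop :=
  [/\ inspan e, e * e = e, e != 0 &
      forall g, inspan g -> g * g = g -> e * g = g -> g * e = g ->
        g = 0 \/ g = e].

Hypothesis ntr_dual : forall k l, ntr (u k * v l) = (k == l)%:R.
Hypothesis inspan_v : forall k, inspan (v k).
Hypothesis inspan_uu : forall k l, inspan (u k * u l).

Lemma ntrC x y : ntr (x * y) = ntr (y * x).
Proof. by rewrite /ntr mxtrace_mulC. Qed.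

Lemma ntrD x y : ntr (x + y) = ntr x + ntr y.
Proof. by rewrite /ntr mxtraceD mulrDl. Qed.

Lemma ntrZ a x : ntr (a *: x) = a * ntr x.
Proof. by rewrite /ntr mxtraceZ mulrA. Qed.

Lemma ntr0 : ntr 0 = 0.
Proof. by rewrite /ntr mxtrace0 mul0r. Qed.

Lemma ntr_sum I (r : seq I) (P : pred I) (F : I -> 'M[C]_d.+1) :
  ntr (\sum_(i <- r | P i) F i) = \sum_(i <- r | P i) ntr (F i).
Proof. exact: (big_morph _ ntrD ntr0). Qed.

Lemma ntr_nilpotent x k : x ^+ k = 0 -> ntr x = 0.
Proof. by move=> xk; rewrite /ntr (@mxtrace_nilpotent C d.+1 x k) ?mul0r. Qed.

Lemma ntr_idem x : x * x = x -> ntr x = (\rank x)%:R / d.+1%:R.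
Proof. by move=> xx; rewrite /ntr mxtrace_idem. Qed.

Lemma ntr_idem_neq0 x : x * x = x -> x != 0 -> ntr x != 0.
Proof.
move=> xx x0; rewrite ntr_idem // mulf_neq0 ?invr_eq0 ?pnatr_eq0 //.
by rewrite mxrank_eq0.
Qed.

Lemma inspan_u k : inspan (u k).
Proof.
exists (fun l => (l == k)%:R); rewrite (bigD1 k) //= eqxx scale1r big1 ?addr0 //.
by move=> l /negPf ->; rewrite scale0r.
Qed.

Lemma inspan0 : inspan 0.
Proof. by exists (fun=> 0); rewrite big1 // => k _; rewrite scale0r. Qed.

Lemma inspanD x y : inspan x -> inspan y -> inspan (x + y).
Proof.
move=> [a ->] [b ->]; exists (fun k => a k + b k).
by rewrite -big_split; apply: eq_bigr => k _; rewrite scalerDl.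
Qed.

Lemma inspanZ c x : inspan x -> inspan (c *: x).
Proof.
move=> [a ->]; exists (fun k => c * a k).
by rewrite scaler_sumr; apply: eq_bigr => k _; rewrite scalerA.
Qed.

Lemma inspanB x y : inspan x -> inspan y -> inspan (x - y).
Proof. by move=> sx sy; rewrite -scaleN1r; apply/inspanD/inspanZ. Qed.

Lemma inspan_sum I (r : seq I) (F : I -> 'M[C]_d.+1) :
  (forall i, inspan (F i)) -> inspan (\sum_(i <- r) F i).
Proof. by move=> sF; apply: big_ind => //; [exact: inspan0|exact: inspanD]. Qed.

Lemma inspanM x y : inspan x -> inspan y -> inspan (x * y).
Proof.
move=> [a ->] [b ->]; rewrite mulr_suml; apply: inspan_sum => k.
rewrite mulr_sumr; apply: inspan_sum => l.
by rewrite -scalerAl -scalerAr scalerA; apply: inspanZ.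
Qed.

Lemma inspan_horner e x q :
  inspan e -> inspan x -> inspan (e * horner_mx x q).
Proof.
move=> se sx; elim/poly_ind: q => [|q c IH]; first by rewrite rmorph0 mulr0; exact: inspan0.
rewrite rmorphD rmorphM /= horner_mx_X horner_mx_C mulrDr mulrA.
by apply: inspanD; [exact: inspanM|rewrite -scalemx1 -scalerAr mulr1; exact: inspanZ].
Qed.

Lemma coord_u x : inspan x -> x = \sum_k ntr (x * v k) *: u k.
Proof.
move=> [a ->]; apply: eq_bigr => k _; congr (_ *: _).
rewrite mulr_suml ntr_sum (bigD1 k) //= big1 => [|l lk].
  by rewrite addr0 -scalerAl ntrZ ntr_dual eqxx mulr1.
by rewrite -scalerAl ntrZ ntr_dual (negPf lk) mulr0.
Qed.

Lemma ntr_nondeg x :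
  inspan x -> (forall k, ntr (x * v k) = 0) -> x = 0.
Proof. by move=> sx x0; rewrite (coord_u sx) big1 // => k _; rewrite x0 scale0r. Qed.

(** The difference of the two sides pairs to zero with every [u l], hence with every [v k], which
    lies in their span; nondegeneracy makes it zero. *)
Lemma coord_v x : inspan x -> x = \sum_k ntr (x * u k) *: v k.
Proof.
move=> sx; apply/eqP; rewrite -subr_eq0; apply/eqP; set y := x - _.
have sy : inspan y by apply: inspanB => //; apply: inspan_sum => k; exact: inspanZ.
have yu l : ntr (y * u l) = 0.
  rewrite /y mulrBl -scaleN1r ntrD ntrZ mulr_suml ntr_sum (bigD1 l) //= big1 => [|k kl].
    by rewrite addr0 -scalerAl ntrZ (ntrC (v l)) ntr_dual eqxx mulr1 mulN1r subrr.
  by rewrite -scalerAl ntrZ (ntrC (v k)) ntr_dual eq_sym (negPf kl) mulr0.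
apply: ntr_nondeg => // k; have [a ->] := inspan_v k.
rewrite mulr_sumr ntr_sum big1 // => l _.
by rewrite -scalerAr ntrZ yu mulr0.
Qed.

Lemma ntr_parseval x y :
  inspan x -> \sum_k ntr (x * u k) * ntr (y * v k) = ntr (y * x).
Proof.
move=> sx; rewrite [in RHS](coord_v sx) mulr_sumr ntr_sum.
by apply: eq_bigr => k _; rewrite -scalerAr ntrZ.
Qed.

(** [z] is [a e] plus a nilpotent [y] commuting with the span. Every [y * v l] is then nilpotent and
    traceless, so [y = 0] by nondegeneracy. *)
Lemma prim_central_scalar e z :
  prim_central e -> inspan z -> commspan z -> e * z = z -> exists c, z = c *: e.
Proof.
move=> [se ce ee e0 pe] sz cz ez; have ze : z * e = z by rewrite cz.
have [|a [k zk]] := primitive_idem_nilpotent e0 ee ez ze.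
  move=> q y yy; apply: pe => //; first exact: inspan_horner.
    move=> w sw; have czq : GRing.comm w (horner_mx z q).
      by apply: comm_mx_horner; rewrite /comm_mx -[_ *m _]/(w * z) -cz.
    by rewrite /y -mulrA -czq mulrA ce // mulrA.
  by rewrite /y mulrA ee.
exists a; apply/eqP; rewrite -subr_eq0; apply/eqP.
have sn : inspan (z - a *: e) by apply: inspanB => //; apply: inspanZ.
apply: ntr_nondeg => // l.
apply: (@ntr_nilpotent _ k); rewrite exprMn_comm ?zk ?mul0r //.
apply: commr_sym; apply: commrB; first by rewrite /GRing.comm cz.
by rewrite /GRing.comm -scalerAr -scalerAl ce.
Qed.

(* A nilpotent [y] of [eRe] is zero: for all [z] in [R], [e z y] is a multiple of
   [e] plus a nilpotent and kills a nonzero vector, so it is nilpotent and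
   [tr (z y) = 0]. *)
Lemma prim_scalar e x :
  prim e -> inspan x -> e * x = x -> x * e = x -> exists c, x = c *: e.
Proof.
move=> [se ee e0 pe].
have local w : inspan w -> e * w = w -> w * e = w ->
    exists a k, (w - a *: e) ^+ k = 0.
  move=> sw ew we; apply: primitive_idem_nilpotent => // q y yy.
  apply: pe => //; first exact: inspan_horner.
    by rewrite /y mulrA ee.
  rewrite /y -mulrA -[X in e * X](comm_mx_horner (A := e) (B := w)).
    by rewrite mulrA ee.
  by rewrite /comm_mx -[_ *m _]/(e * w) ew -[_ *m _]/(w * e) we.
move=> sx ex xe; have [a [k nk]] := local x sx ex xe.
exists a; apply/eqP; rewrite -subr_eq0; apply/eqP; move: nk.
set y := x - a *: e => yk.
have sy : inspan y by apply: inspanB => //; apply: inspanZ.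
have ey : e * y = y by rewrite mulrBr ex -scalerAr ee.
have ye : y * e = y by rewrite mulrBl xe -scalerAl ee.
have [t [t0 et yt]] : exists t, [/\ t != 0, e * t = t & y * t = 0].
  have ex_k : exists k, y ^+ k == 0 by exists k; apply/eqP.
  have [[|m] /eqP ym min_m] := ex_minnP ex_k.
    by move: ym; rewrite expr0 => /eqP; rewrite oner_eq0.
  (* With [m.+1] the nilpotency index of [y], this is the last nonzero power, and it is [e] itself
     when [m = 0]. *)
  exists (e * y ^+ m); split; last by rewrite mulrA ye -exprS.
    case: m ym min_m => [|m] ym min_m; first by rewrite expr0 mulr1.
    rewrite exprS mulrA ey -exprS; apply/negP => /min_m.
    by rewrite ltnn.
  by rewrite mulrA ee.
apply: ntr_nondeg => // l; rewrite ntrC -ye mulrA ntrC.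
set w := e * _.
have sw : inspan w by rewrite /w; do 2!apply: inspanM => //.
have [||b [j wj]] := local w sw.
- by rewrite /w mulrA ee.
- by rewrite /w -!mulrA ye.
(* On [t] the nilpotent [w - b e] acts as multiplication by [- b], which forces [b = 0]; so [w]
   itself is nilpotent. *)
have wt : (w - b *: e) * t = - b *: t.
  by rewrite mulrBl /w -!mulrA yt !mulr0 sub0r -scalerAl et scaleNr.
have wjt i : (w - b *: e) ^+ i * t = (- b) ^+ i *: t.
  elim: i => [|i IH]; first by rewrite !expr0 mul1r scale1r.
  by rewrite exprSr -mulrA wt -scalerAr IH scalerA exprS.
move: (wjt j); rewrite wj mul0r => /esym/eqP.
rewrite scaler_eq0 (negPf t0) orbF expf_eq0 oppr_eq0 => /andP[_ /eqP b0].
by apply: (@ntr_nilpotent _ j); rewrite -wj b0 scale0r subr0.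
Qed.

(** The Higman trace of the symmetric algebra spanned by the [u k]. *)
Definition casimir z : 'M[C]_d.+1 := \sum_k u k * z * v k.

(** Expanding [x u_k] in the [u l] and [v_l x] in the [v k] produces the same coefficients
    [ntr (x u_k v_l)]. *)
Lemma casimir_comm z : commspan (casimir z).
Proof.
move=> x sx; apply/esym; rewrite mulr_sumr mulr_suml.
transitivity (\sum_k \sum_l ntr (x * u k * v l) *: (u l * z * v k)).
  apply: eq_bigr => k _; rewrite !mulrA.
  rewrite [X in X * z * _](coord_u (inspanM sx (inspan_u k))) !mulr_suml.
  by apply: eq_bigr => l _; rewrite -!scalerAl.
rewrite exchange_big; apply: eq_bigr => l _ /=.
rewrite -[in RHS]mulrA [v l * x](coord_v (inspanM (inspan_v l) sx)) mulr_sumr.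
by apply: eq_bigr => k _; rewrite -scalerAr -!mulrA [in RHS]ntrC mulrA.
Qed.

Lemma inspan_casimir z : inspan z -> inspan (casimir z).
Proof.
by move=> sz; apply: inspan_sum => k; do 2!apply: inspanM => //; exact: inspan_u.
Qed.

(** Both sides expand over the [u l] with the symmetric coefficients [ntr (v_k v_l)]. *)
Lemma casimir_flip : \sum_k v k * u k = \sum_k u k * v k.
Proof.
transitivity (\sum_k \sum_l ntr (v k * v l) *: (u l * u k)).
  apply: eq_bigr => k _; rewrite {1}(coord_u (inspan_v k)) mulr_suml.
  by apply: eq_bigr => l _; rewrite -scalerAl.
rewrite exchange_big; apply: eq_bigr => l _ /=.
rewrite [in RHS](coord_u (inspan_v l)) mulr_sumr.
by apply: eq_bigr => k _; rewrite -scalerAr ntrC.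
Qed.

(** The sum is the trace of left multiplication by [f] on the span, later the dimension of [f R(H)].
    Since [casimir f] is central and lies under [e], it is [c e]; tracing it gives [c * ntr e] as
    that sum, and tracing [f * casimir f] gives [c * ntr f = 1]. *)
Lemma ntr_prim_central e f :
  prim_central e -> prim f -> f * e = f ->
  ntr e = (\sum_k ntr (f * u k * v k)) * ntr f.
Proof.
move=> pe pf fe; have [se ce ee e0 _] := pe; have [sf ff f0 _] := pf.
have cfe : casimir f * e = casimir f.
  rewrite mulr_suml; apply: eq_bigr => k _.
  by rewrite -mulrA -ce // mulrA -(mulrA _ f) fe.
have [c cE] : exists c, casimir f = c *: e.
  apply: prim_central_scalar => //; first exact: inspan_casimir.
    exact: casimir_comm.
  by rewrite ce //; exact: inspan_casimir.
have tE : \sum_k ntr (f * u k * v k) = c * ntr e.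
  rewrite -ntrZ -cE; transitivity (ntr (f * \sum_k u k * v k)).
    by rewrite mulr_sumr ntr_sum; apply: eq_bigr => k _; rewrite mulrA.
  rewrite -casimir_flip mulr_sumr !ntr_sum.
  by apply: eq_bigr => k _; rewrite mulrA ntrC mulrA.
rewrite tE mulrAC.
suff -> : c * ntr f = 1 by rewrite mul1r.
have -> : c * ntr f = ntr (f * casimir f) by rewrite cE -scalerAr fe ntrZ.
rewrite mulr_sumr ntr_sum.
have fuf k : exists b, f * u k * f = b *: f.
  apply: prim_scalar => //; last by rewrite -!mulrA ff.
    by do 2!apply: inspanM => //; exact: inspan_u.
  by rewrite !mulrA ff.
have [b bE] : exists b : 'I_n -> C, forall k, f * u k * f = b k *: f.
  (* The scalars are chosen for all [k] at once; [sigW] works on boolean predicates, hence the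
     passage to [==]. *)
  by exists (fun k => sval (sigW (P := fun b => f * u k * f == b *: f)
     (let: ex_intro b e := fuf k in ex_intro _ b (introT eqP e)))) => k; case: sigW => ? /= /eqP.
(* Expand the middle factor of [f = f f f] in the [u k]. *)
have E : f = (\sum_k ntr (f * v k) * b k) *: f.
  rewrite -[LHS]ff -{1}[f in f * _]ff {2}(coord_u sf) mulr_sumr mulr_suml scaler_suml.
  by apply: eq_bigr => k _; rewrite -scalerAr -scalerAl bE scalerA.
transitivity (\sum_k ntr (f * v k) * b k).
  by apply: eq_bigr => k _; rewrite !mulrA bE -scalerAl ntrZ mulrC.
apply/eqP; rewrite -subr_eq0; move/eqP: E; rewrite -subr_eq0 -[X in X - _]scale1r -scalerBl.
by rewrite scaler_eq0 (negPf f0) orbF -opprB oppr_eq0.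
Qed.

(** [g e] is a central idempotent below both [e] and [g], so if nonzero it equals both. *)
Lemma prim_central_orthogonal e g :
  prim_central e -> prim_central g -> e != g -> g * e = 0.
Proof.
move=> pe pg eg; have [se ce ee e0 ple] := pe; have [sg cg gg g0 plg] := pg.
have cge : commspan (g * e) by move=> y sy; rewrite -mulrA ce // mulrA cg // mulrA.
have sge : inspan (g * e) by exact: inspanM.
have ige : g * e * (g * e) = g * e by rewrite mulrA -(mulrA g) ce // mulrA gg -mulrA ee.
have ege : e * (g * e) = g * e by rewrite mulrA ce // -mulrA ee.
have gge : g * (g * e) = g * e by rewrite mulrA gg.
have [//|ge] := ple _ sge cge ige ege.
have [//|gg'] := plg _ sge cge ige gge.
by case/eqP: eg; rewrite -gg' ge.
Qed.

(** * The positive involution of the span *)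

Hypothesis real_vv : forall k l, (ntr (v k * v l))^* = ntr (v k * v l).
Hypothesis real_uuv : forall k l m,
  (ntr (u k * u l * v m))^* = ntr (u k * u l * v m).
(** Together with [vv_uuv]: the linear extension of [u k |-> v k] is involutive and reverses
    products. *)
Hypothesis u_vv : forall k, u k = \sum_l ntr (v k * v l) *: v l.
Hypothesis vv_uuv : forall k l, v l * v k = \sum_m ntr (u k * u l * v m) *: v m.

Definition star (x : 'M[C]_d.+1) : 'M[C]_d.+1 :=
  \sum_k (ntr (x * v k))^* *: v k.

Lemma inspan_star x : inspan (star x).
Proof. by apply: inspan_sum => k; exact: inspanZ. Qed.

Lemma starD x y : star (x + y) = star x + star y.
Proof.
rewrite /star -big_split; apply: eq_bigr => k _ /=.
by rewrite mulrDl ntrD rmorphD scalerDl.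
Qed.

Lemma starZ a x : star (a *: x) = a^* *: star x.
Proof.
rewrite /star scaler_sumr; apply: eq_bigr => k _ /=.
by rewrite -scalerAl ntrZ rmorphM scalerA.
Qed.

Lemma star0 : star 0 = 0.
Proof. by rewrite -[X in star X](scale0r 0) starZ conjC0 scale0r. Qed.

Lemma star_sum I (r : seq I) (F : I -> 'M[C]_d.+1) :
  star (\sum_(i <- r) F i) = \sum_(i <- r) star (F i).
Proof. exact: (big_morph _ starD star0). Qed.

Lemma star_u k : star (u k) = v k.
Proof.
rewrite /star (bigD1 k) //= ntr_dual eqxx conjC1 scale1r big1 ?addr0 // => l lk.
by rewrite ntr_dual eq_sym (negPf lk) conjC0 scale0r.
Qed.

Lemma star_v k : star (v k) = u k.
Proof. by rewrite [RHS]u_vv; apply: eq_bigr => l _; rewrite real_vv. Qed.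

Lemma starK x : inspan x -> star (star x) = x.
Proof.
move=> [a ->]; rewrite [X in star X]star_sum star_sum; apply: eq_bigr => k _.
by rewrite !starZ conjCK star_u star_v.
Qed.

Lemma starM x y : inspan x -> inspan y -> star (x * y) = star y * star x.
Proof.
move=> [a ->] [b ->]; rewrite !star_sum !mulr_suml star_sum.
under eq_bigr do rewrite mulr_sumr star_sum.
rewrite exchange_big; apply: eq_bigr => l _ /=.
rewrite mulr_sumr; apply: eq_bigr => k _.
rewrite -scalerAl -scalerAr scalerA !starZ.
rewrite -scalerAl -scalerAr scalerA rmorphM mulrC !star_u vv_uuv; congr (_ *: _).
by apply: eq_bigr => m _; rewrite real_uuv.
Qed.

(** For [x = \sum_k a_k u_k] the trace is the sum of the [|a_k|^2], because the [v k] are dual to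
    the [u k]. *)
Lemma ntr_star_neq0 x : inspan x -> x != 0 -> ntr (x * star x) != 0.
Proof.
move=> sx x0; have [a xE] := sx; have aE k : ntr (x * v k) = a k.
  rewrite xE mulr_suml ntr_sum (bigD1 k) //= big1 => [|l lk].
    by rewrite -scalerAl ntrZ ntr_dual eqxx mulr1 addr0.
  by rewrite -scalerAl ntrZ ntr_dual (negPf lk) mulr0.
have -> : ntr (x * star x) = \sum_k `|a k| ^+ 2.
  rewrite mulr_sumr ntr_sum; apply: eq_bigr => k _.
  by rewrite -scalerAr ntrZ aE normCKC.
rewrite psumr_eq0 => [|k _]; last by rewrite exprn_ge0.
apply: contra x0 => /allP a0; rewrite xE big1 // => k _.
have /= := a0 k (mem_index_enum _).
by rewrite sqrf_eq0 normr_eq0 => /eqP ->; rewrite scale0r.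
Qed.

(** [star e] is again a central idempotent, so [e * star e = c *: e]. Positivity excludes [c = 0]
    and idempotence leaves [c = 1]; thus [e] equals [e * star e], which is self-adjoint. *)
Lemma star_prim_central e : prim_central e -> star e = e.
Proof.
move=> pe; have [se ce ee e0 _] := pe; have ss := inspan_star e.
have cs : commspan (star e).
  move=> y sy; have sy' := inspan_star y.
  by rewrite -(starK sy) -!starM // ce.
have [c cE] : exists c, e * star e = c *: e.
  apply: prim_central_scalar => //; first exact: inspanM.
    by move=> y sy; rewrite -mulrA cs // mulrA ce // mulrA.
  by rewrite mulrA ee.
have c0 : c != 0.
  apply: contraNneq (ntr_star_neq0 se e0) => c0.
  by rewrite cE c0 scale0r ntr0.
have ess : star e * star e = star e by rewrite -starM // ee.
have c1 : c = 1.
  have : e * star e * (e * star e) = e * star e.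
    by rewrite mulrA -(mulrA e) cs // mulrA ee -mulrA ess.
  rewrite cE -scalerAl -scalerAr ee => /eqP; rewrite -subr_eq0 -scalerBr scaler_eq0 (negPf c0) /=.
  rewrite -{2}[e]scale1r -scalerBl scaler_eq0 (negPf e0) orbF subr_eq0 => /eqP //.
have E : e * star e = e by rewrite cE c1 scale1r.
by rewrite -{1}E starM // starK.
Qed.

Lemma prim_central_gram e g :
  prim_central e -> prim_central g ->
  \sum_k ntr (e * u k) * (ntr (g * u k))^* = (e == g)%:R * ntr e.
Proof.
move=> pe pg; have [se _ ee _ _] := pe; have [sg _ _ _ _] := pg.
have conj_g k : (ntr (g * u k))^* = ntr (g * v k).
  rewrite -{1}(star_prim_central pg) mulr_suml ntr_sum (bigD1 k) //= big1 => [|l lk].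
    by rewrite -scalerAl ntrZ (ntrC (v k)) ntr_dual eqxx mulr1 addr0 conjCK.
  by rewrite -scalerAl ntrZ (ntrC (v l)) ntr_dual eq_sym (negPf lk) mulr0.
under eq_bigr do rewrite conj_g.
rewrite ntr_parseval //; have [<-|ne] := eqVneq e g; first by rewrite ee mul1r.
by rewrite prim_central_orthogonal // ntr0 mul0r.
Qed.

End DualBases.

(** * Hopf algebras in coordinates *)

Section LinearCombinations.
Variables (K : comNzRingType) (d p q : nat) (M : 'I_d -> 'M[K]_(p, q)).

(* Locked, since otherwise [linear_sum] unifies [lcomb x] itself with a sum. *)
Definition lcomb (x : 'rV[K]_d) : 'M[K]_(p, q) :=
  locked (\sum_a x 0 a *: M a).

Lemma lcomb_sum x : lcomb x = \sum_a x 0 a *: M a.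
Proof. by rewrite /lcomb -lock. Qed.

Lemma lcomb_is_linear : linear lcomb.
Proof.
move=> c x y; rewrite !lcomb_sum scaler_sumr -big_split; apply: eq_bigr => a _ /=.
by rewrite !mxE scalerDl scalerA.
Qed.
HB.instance Definition _ :=
  GRing.isLinear.Build K 'rV[K]_d 'M[K]_(p, q) _ lcomb lcomb_is_linear.

Lemma lcomb_delta a : lcomb (delta_mx 0 a) = M a.
Proof.
rewrite lcomb_sum (bigD1 a) //= mxE !eqxx scale1r big1 ?addr0 // => b /negPf ba.
by rewrite mxE eqxx ba scale0r.
Qed.

Lemma lcomb_mulmx (x : 'rV[K]_d) (A : 'M[K]_d) :
  lcomb (x *m A) = \sum_a x 0 a *: lcomb (row a A).
Proof.
rewrite {1}[x]row_sum_delta mulmx_suml linear_sum; apply: eq_bigr => a _.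
by rewrite -scalemxAl linearZ -rowE.
Qed.

End LinearCombinations.

Section HopfAlgebra.
Variables (R : realType) (d : nat) (H : hopf_data R d).
Hypothesis HH : is_hopf_algebra H.
Local Notation C := R[i].
Local Notation one := (hone H).
Local Notation eps := (heps H).

(* Row-vector conventions: [y *m lmul x = xy], [x *m rmul y = xy], [x *m antip]
   is the antipode, [h *m act p = h <- p], and [comul h] is the coefficient
   matrix of Delta h in H (x) H. *)
Definition lmulb a : 'M[C]_d := \matrix_(b, c) hmu H a b c.
Definition comulb a : 'M[C]_d := \matrix_(b, c) hDelta H a b c.
Definition rmulb b : 'M[C]_d := \matrix_(a, c) hmu H a b c.
Definition actb b : 'M[C]_d := \matrix_(a, c) hDelta H a b c.
Local Notation lmul := (lcomb lmulb).
Local Notation rmul := (lcomb rmulb).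
Local Notation comul := (lcomb comulb).
Local Notation act := (lcomb actb).
Definition antip : 'M[C]_d := \matrix_(a, b) hS H a b.

Lemma eq_mx_rV m (A B : 'M[C]_(d, m)) :
  (forall x : 'rV_d, x *m A = x *m B) -> A = B.
Proof. by move=> AB; apply/row_matrixP => i; rewrite !rowE AB. Qed.

Lemma lcombE p q (M : 'I_d -> 'M[C]_(p, q)) x i j :
  lcomb M x i j = \sum_a x 0 a * M a i j.
Proof. by rewrite lcomb_sum summxE; apply: eq_bigr => a _; rewrite mxE. Qed.

Lemma hmul_lmul x y : hmul H x y = y *m lmul x.
Proof.
apply/rowP => c; rewrite !mxE exchange_big; apply: eq_bigr => b _ /=.
rewrite lcombE mulr_sumr; apply: eq_bigr => a _; rewrite mxE; ring.
Qed.

Lemma hmul_rmul x y : hmul H x y = x *m rmul y.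
Proof.
apply/rowP => c; rewrite !mxE; apply: eq_bigr => a _ /=.
rewrite lcombE mulr_sumr; apply: eq_bigr => b _; rewrite mxE; ring.
Qed.

Lemma lmulM x y : lmul (hmul H x y) = lmul y *m lmul x.
Proof.
by apply: eq_mx_rV => z; rewrite mulmxA -!hmul_lmul (proj1 HH).
Qed.

Lemma mul1h x : hmul H one x = x.
Proof. by have [_ [/(_ x)[]]] := HH. Qed.

Lemma mulh1 x : hmul H x one = x.
Proof. by have [_ [/(_ x)[]]] := HH. Qed.

Lemma lmul1 : lmul one = 1%:M.
Proof. by apply: eq_mx_rV => z; rewrite -hmul_lmul mul1h mulmx1. Qed.

Lemma hpairE (p h : 'rV[C]_d) : hpair p h = (p *m h^T) 0 0.
Proof. by rewrite mxE; apply: eq_bigr => a _; rewrite mxE. Qed.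

Lemma hpairC (p h : 'rV[C]_d) : hpair p h = hpair h p.
Proof. by apply: eq_bigr => a _; rewrite mulrC. Qed.

Lemma hpairZr (p h : 'rV[C]_d) a : hpair p (a *: h) = a * hpair p h.
Proof. by rewrite !hpairE linearZ -scalemxAr mxE. Qed.

Lemma hpairZl (p h : 'rV[C]_d) a : hpair (a *: p) h = a * hpair p h.
Proof. by rewrite hpairC hpairZr hpairC. Qed.

Lemma hpair_sumr I r (P : pred I) (p : 'rV[C]_d) F :
  hpair p (\sum_(i <- r | P i) F i) = \sum_(i <- r | P i) hpair p (F i).
Proof.
rewrite hpairE linear_sum mulmx_sumr summxE; apply: eq_bigr => i _.
by rewrite hpairE.
Qed.

Lemma hpair_delta (p : 'rV[C]_d) a : hpair p (delta_mx 0 a) = p 0 a.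
Proof. by rewrite hpairE trmx_delta -colE mxE. Qed.

Lemma hpair_mulmx (p h : 'rV[C]_d) A : hpair (p *m A) h = hpair p (h *m A^T).
Proof. by rewrite !hpairE trmx_mul trmxK mulmxA. Qed.

Lemma hlharp_comul h p : hlharp H h p = p *m comul h.
Proof.
apply/rowP => c; rewrite !mxE exchange_big; apply: eq_bigr => b _ /=.
rewrite lcombE mulr_sumr; apply: eq_bigr => a _; rewrite mxE; ring.
Qed.

Lemma hlharp_act h p : hlharp H h p = h *m act p.
Proof.
apply/rowP => c; rewrite !mxE; apply: eq_bigr => a _ /=.
rewrite lcombE mulr_sumr; apply: eq_bigr => b _; rewrite mxE; ring.
Qed.

Lemma hpair_dmul p q h : hpair (dmul H p q) h = hpair q (p *m comul h).
Proof.
rewrite -hlharp_comul /hpair.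
transitivity (\sum_c \sum_a \sum_b p 0 a * q 0 b * hDelta H c a b * h 0 c).
  apply: eq_bigr => c _; rewrite mxE mulr_suml; apply: eq_bigr => a _.
  by rewrite mulr_suml.
under eq_bigr do rewrite exchange_big.
rewrite exchange_big; apply: eq_bigr => b _ /=.
rewrite mxE mulr_sumr; apply: eq_bigr => c _.
rewrite mulr_sumr; apply: eq_bigr => a _ /=; ring.
Qed.

Lemma hpair_ext (p q : 'rV[C]_d) : (forall h, hpair p h = hpair q h) -> p = q.
Proof.
move=> pq; apply/rowP => a; have := pq (delta_mx 0 a).
by rewrite !hpair_delta.
Qed.

Lemma counitl h : eps *m comul h = h.
Proof.
have [_ [_ [_ [eD _]]]] := HH.
rewrite -hlharp_comul; apply/rowP => c; rewrite mxE (bigD1 c) //=.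
have E a : \sum_b h 0 a * eps 0 b * hDelta H a b c = h 0 a * (a == c)%:R.
  by rewrite -eD mulr_sumr; apply: eq_bigr => b _; ring.
rewrite E eqxx mulr1 big1 ?addr0 // => a /negPf ac.
by rewrite E ac mulr0.
Qed.

Lemma counitr h : eps *m (comul h)^T = h.
Proof.
have [_ [_ [_ [_ [De _]]]]] := HH.
apply/rowP => c; rewrite mxE.
transitivity (\sum_a h 0 a * (a == c)%:R).
  under eq_bigr do rewrite mxE lcombE mulr_sumr.
  rewrite exchange_big; apply: eq_bigr => a _ /=.
  by rewrite -De mulr_sumr; apply: eq_bigr => b _; rewrite mxE; ring.
rewrite (bigD1 c) //= eqxx mulr1 big1 ?addr0 // => a /negPf ac.
by rewrite ac mulr0.
Qed.

(** Multiplicativity of Delta: the two factors of [Delta e_a] act on the two sides of the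
    coefficient matrix of [Delta x]. *)
Lemma comul_lmulb a x :
  comul (x *m lmulb a) =
  \sum_r \sum_s hDelta H a r s *: ((lmulb r)^T *m comul x *m lmulb s).
Proof.
have [_ [_ [_ [_ [_ [muD _]]]]]] := HH.
rewrite lcomb_mulmx [in RHS]lcomb_sum.
under [RHS]eq_bigr do under eq_bigr do
  rewrite mulmx_sumr mulmx_suml scaler_sumr.
under [RHS]eq_bigr do rewrite exchange_big.
rewrite exchange_big; apply: eq_bigr => b _ /=.
transitivity (x 0 b *: \sum_r \sum_s hDelta H a r s *: ((lmulb r)^T *m comulb b *m lmulb s)).
  congr (_ *: _); apply/matrixP => i j; rewrite lcombE summxE.
  transitivity (\sum_c hmu H a b c * hDelta H c i j).
    by apply: eq_bigr => c _; rewrite !mxE.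
  rewrite muD; apply: eq_bigr => p _; rewrite summxE; apply: eq_bigr => q _.
  rewrite !mxE exchange_big mulr_sumr; apply: eq_bigr => s _ /=.
  rewrite !mxE mulr_suml mulr_sumr; apply: eq_bigr => r _.
  by rewrite !mxE; ring.
rewrite scaler_sumr; apply: eq_bigr => r _.
rewrite scaler_sumr; apply: eq_bigr => s _.
by rewrite -scalemxAr -scalemxAl !scalerA mulrC.
Qed.

Lemma hmul_deltal a x : hmul H (delta_mx 0 a) x = x *m lmulb a.
Proof. by rewrite hmul_lmul lcomb_delta. Qed.

Lemma antipode_comulb a :
  \sum_p \sum_q hDelta H a p q *: (row p antip *m rmul (delta_mx 0 q)) =
  eps 0 a *: one.
Proof.
have [_ [_ [_ [_ [_ [_ [_ [_ [_ [Sl _]]]]]]]]]] := HH.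
apply/rowP => c; rewrite [RHS]mxE -Sl summxE; apply: eq_bigr => p _.
rewrite summxE; apply: eq_bigr => q _; rewrite mxE -hmul_rmul mxE mulr_sumr.
apply: eq_bigr => r _; rewrite (bigD1 q) //= big1 => [|b bq]; rewrite !mxE.
  by rewrite !eqxx mulr1 addr0 mulrA.
by rewrite (negPf bq) andbF mulr0 mul0r.
Qed.

Lemma antipode_comul h :
  \sum_p \sum_q comul h p q *: (row p antip *m rmul (delta_mx 0 q)) =
  hpair eps h *: one.
Proof.
under eq_bigr do under eq_bigr do rewrite lcombE scaler_suml.
under eq_bigr do rewrite exchange_big.
rewrite exchange_big /hpair scaler_suml; apply: eq_bigr => a _ /=.
rewrite mulrC -scalerA -antipode_comulb scaler_sumr; apply: eq_bigr => p _.
by rewrite scaler_sumr; apply: eq_bigr => q _; rewrite mxE scalerA.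
Qed.

Lemma comulb_coassoc a p r s :
  \sum_q hDelta H a p q * hDelta H q r s = \sum_q hDelta H a q s * hDelta H q p r.
Proof. by have [_ [_ [-> _]]] := HH. Qed.

(* [S(h_1) (h_2 x)_1 (x) (h_2 x)_2 = x_1 (x) h x_2] for [h = e_a]. *)
Lemma antip_comul_lmulb a x :
  \sum_p \sum_q hDelta H a p q *: ((lmul (row p antip))^T *m comul (x *m lmulb q)) =
  comul x *m lmulb a.
Proof.
(* Coassociativity regroups [S(h_1) h_2 x_1 (x) h_3 x_2] so that [S(h_1) h_2] collapses to the
   counit. *)
transitivity (\sum_s \sum_q hDelta H a q s *:
    ((\sum_p \sum_r hDelta H q p r *: ((lmul (row p antip))^T *m (lmulb r)^T))
       *m comul x *m lmulb s)).
  transitivity (\sum_s \sum_p \sum_r (\sum_q hDelta H a p q * hDelta H q r s) *: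
      ((lmul (row p antip))^T *m (lmulb r)^T *m comul x *m lmulb s)).
    rewrite [RHS]exchange_big; apply: eq_bigr => p _ /=.
    under eq_bigr do rewrite comul_lmulb mulmx_sumr scaler_sumr.
    rewrite exchange_big [RHS]exchange_big; apply: eq_bigr => r _ /=.
    under eq_bigr do rewrite mulmx_sumr scaler_sumr.
    rewrite exchange_big; apply: eq_bigr => s _ /=.
    rewrite scaler_suml; apply: eq_bigr => q _.
    by rewrite -scalemxAr scalerA !mulmxA.
  apply: eq_bigr => s _.
  under eq_bigr do under eq_bigr do rewrite comulb_coassoc scaler_suml.
  under eq_bigr do rewrite exchange_big.
  rewrite exchange_big; apply: eq_bigr => q _ /=.
  rewrite !mulmx_suml scaler_sumr; apply: eq_bigr => p _.
  rewrite !mulmx_suml scaler_sumr; apply: eq_bigr => r _.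
  by rewrite -!scalemxAl scalerA.
have E q : \sum_p \sum_r hDelta H q p r *: ((lmul (row p antip))^T *m (lmulb r)^T) =
    eps 0 q *: 1%:M.
  rewrite -trmx1 -lmul1 -linearZ -[in RHS]linearZ /= -antipode_comulb.
  rewrite !(linear_sum, raddf_sum); apply: eq_bigr => p _ /=.
  rewrite !(linear_sum, raddf_sum); apply: eq_bigr => r _ /=.
  rewrite -trmx_mul -hmul_rmul 2!linearZ; congr (_ *: _^T).
  by rewrite /= lmulM lcomb_delta.
have [_ [_ [_ [eD [De _]]]]] := HH.
under eq_bigr do under eq_bigr do rewrite E -!scalemxAl mul1mx scalerA mulrC.
under eq_bigr do rewrite -scaler_suml eD.
rewrite (bigD1 a) //= eqxx scale1r big1 ?addr0 // => s /negPf sa.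
by rewrite eq_sym sa scale0r.
Qed.

(** Coassociativity makes [h <- p] a right action, and on row vectors matrices multiply in that
    order. So [act] represents the algebra [H^*] by matrices. *)
Lemma actM p q : act (dmul H p q) = act p *m act q.
Proof.
apply/matrixP => a c; rewrite lcombE mxE.
transitivity (\sum_r \sum_s p 0 r * q 0 s * \sum_b hDelta H a b c * hDelta H b r s).
  under [RHS]eq_bigr do under eq_bigr do rewrite mulr_sumr.
  under [RHS]eq_bigr do rewrite exchange_big.
  rewrite [RHS]exchange_big; apply: eq_bigr => b _ /=.
  rewrite !mxE mulr_suml; apply: eq_bigr => r _.
  by rewrite mulr_suml; apply: eq_bigr => s _; ring.
under eq_bigr do under eq_bigr do rewrite -comulb_coassoc mulr_sumr.
under eq_bigr do rewrite exchange_big.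
rewrite exchange_big; apply: eq_bigr => x _ /=.
rewrite !lcombE mulr_suml; apply: eq_bigr => r _.
rewrite mulr_sumr; apply: eq_bigr => s _; rewrite !mxE; ring.
Qed.

Lemma act_eps : act eps = 1%:M.
Proof. by apply: eq_mx_rV => h; rewrite -hlharp_act hlharp_comul counitl mulmx1. Qed.

Lemma hpair_act p h : hpair eps (h *m act p) = hpair p h.
Proof.
by rewrite -hlharp_act hlharp_comul hpairC hpair_mulmx counitr.
Qed.

Lemma act_inj : injective act.
Proof. by move=> p q pq; apply: hpair_ext => h; rewrite -[LHS]hpair_act -[RHS]hpair_act pq. Qed.

(** Links left multiplication by [p] on [H^*] to [act p] by transposition, so that both have the
    same trace and rank. *)
Lemma dmul_act p q : dmul H p q = q *m (act p)^T.
Proof.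
by apply: hpair_ext => h; rewrite hpair_dmul hpair_mulmx trmxK -hlharp_comul hlharp_act.
Qed.

(** By coassociativity both sides hold the coefficients of [p(h_1) h_3 (x) h_2]. *)
Lemma comul_act h p : (comul h)^T *m act p = (comul (p *m comul h))^T.
Proof.
apply/matrixP => a c; rewrite !mxE lcombE.
transitivity (\sum_x h 0 x * \sum_e p 0 e * \sum_b hDelta H x b a * hDelta H b e c).
  under eq_bigr do rewrite mxE !lcombE mulr_suml.
  rewrite exchange_big; apply: eq_bigr => x _ /=; rewrite mulr_sumr.
  under [RHS]eq_bigr do rewrite mulr_sumr mulr_sumr.
  rewrite [RHS]exchange_big; apply: eq_bigr => b _ /=; rewrite mulr_sumr.
  by apply: eq_bigr => e _; rewrite !mxE; ring.
under eq_bigr do under eq_bigr do rewrite -comulb_coassoc.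
under [RHS]eq_bigr do rewrite mxE mulr_suml.
rewrite [RHS]exchange_big; under eq_bigr do rewrite mulr_sumr.
rewrite [LHS]exchange_big; apply: eq_bigr => e _ /=.
under [RHS]eq_bigr do rewrite lcombE mulr_sumr mulr_suml.
rewrite [RHS]exchange_big; apply: eq_bigr => x _ /=; rewrite !mulr_sumr.
by apply: eq_bigr => b _; rewrite !mxE; ring.
Qed.

End HopfAlgebra.

(** * Integrals and the antipode *)

Section Integrals.
Variables (R : realType) (d : nat) (H : hopf_data R d).
Local Notation C := R[i].
Local Notation one := (hone H).
Local Notation eps := (heps H).
Local Notation lmul := (lcomb (lmulb H)).
Local Notation rmul := (lcomb (rmulb H)).
Local Notation comul := (lcomb (comulb H)).
Local Notation act := (lcomb (actb H)).
Local Notation antip := (antip H).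
Variables L lam : 'rV[C]_d.
Hypothesis HH : is_hopf_algebra H.
Hypothesis integral_L : is_integral H L.
Hypothesis integral_lam : is_dual_integral H lam.
Hypothesis lam_L : hpair lam L = 1.

(** The Gram matrix of the Frobenius form [(x, y) |-> lambda(xy)]. *)
Definition gram : 'M[C]_d := \matrix_(a, b) \sum_c hmu H a b c * lam 0 c.

Lemma row_gram a : row a gram = lam *m (lmulb H a)^T.
Proof.
by apply/rowP => b; rewrite !mxE; apply: eq_bigr => c _; rewrite !mxE mulrC.
Qed.

Lemma mul_gram h : h *m gram = lam *m (lmul h)^T.
Proof.
rewrite mulmx_sum_row lcomb_sum linear_sum mulmx_sumr /=.
by apply: eq_bigr => a _; rewrite row_gram linearZ -scalemxAr.
Qed.

Lemma gramE x y : hpair (x *m gram) y = hpair lam (hmul H x y).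
Proof. by rewrite mul_gram hpair_mulmx trmxK -hmul_lmul. Qed.

Lemma mul_gramT x : x *m gram^T = \row_q hpair lam (x *m lmulb H q).
Proof.
apply/rowP => q; rewrite !mxE; under eq_bigr do rewrite !mxE mulr_sumr.
rewrite exchange_big; apply: eq_bigr => c _ /=; rewrite mxE mulr_sumr.
by apply: eq_bigr => b _; rewrite !mxE; ring.
Qed.

Lemma lam_comul y : lam *m (comul y)^T = hpair lam y *: one.
Proof.
apply: hpair_ext => p; rewrite hpair_mulmx trmxK -(hpair_dmul H p lam).
by rewrite (integral_lam p).1 !hpairZl mulrC (hpairC one).
Qed.

(* [S(h) L_1 (x) L_2 = L_1 (x) h L_2] *)
Lemma L_comul h : (lmul (h *m antip))^T *m comul L = comul L *m lmul h.
Proof.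
rewrite (lcomb_sum _ h) mulmx_sumr.
rewrite mulmx_sum_row linear_sum linear_sum mulmx_suml; apply: eq_bigr => a _ /=.
(* Take [x = L] in the identity for [S(h_1) (h_2 x)_1 (x) (h_2 x)_2]; there [h_2 L = eps(h_2) L]. *)
rewrite -scalemxAr -antip_comul_lmulb // linearZ linearZ -scalemxAl /=; congr (_ *: _).
have De : forall b, \sum_c hDelta H a b c * eps 0 c = (a == b)%:R.
  by have [_ [_ [_ [_ [De _]]]]] := HH.
have LE q : L *m lmulb H q = eps 0 q *: L.
  by rewrite -hmul_deltal (integral_L _).1 hpair_delta.
have E p : \sum_q hDelta H a p q *: ((lmul (row p antip))^T *m comul (L *m lmulb H q)) =
    (a == p)%:R *: ((lmul (row p antip))^T *m comul L).
  rewrite -De scaler_suml; apply: eq_bigr => q _.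
  by rewrite LE linearZ -scalemxAr scalerA.
under [RHS]eq_bigr do rewrite E.
rewrite (bigD1 a) //= eqxx scale1r big1 ?addr0 // => p /negPf pa.
by rewrite eq_sym pa scale0r.
Qed.

(* [x_1 lambda(h x_2) = S(h_1) lambda(h_2 x)] *)
Lemma gram_comul h x :
  h *m gram *m (comul x)^T = x *m gram^T *m (comul h)^T *m antip.
Proof.
rewrite (lcomb_sum _ h) linear_sum mulmx_sumr mulmx_suml (mulmx_sum_row h) mulmx_suml.
apply: eq_bigr => a _ /=.
rewrite linearZ /= -scalemxAr -!scalemxAl; congr (_ *: _).
(* [x_1 lambda(h x_2) = S(h_1) (h_2 x)_1 lambda((h_2 x)_2)], and [lambda] being an integral reduces
   [y_1 lambda(y_2)] to [lambda(y) 1]. *)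
rewrite row_gram -mulmxA -trmx_mul -antip_comul_lmulb // [in RHS]mulmx_sum_row.
rewrite linear_sum mulmx_sumr; apply: eq_bigr => p _ /=.
rewrite mul_gramT mxE linear_sum mulmx_sumr scaler_suml; apply: eq_bigr => q _ /=.
rewrite linearZ /= -scalemxAr trmx_mul trmxK mulmxA lam_comul -scalemxAl.
by rewrite -hmul_lmul mulh1 // scalerA !mxE mulrC.
Qed.

Lemma L_gramT : L *m gram^T = eps.
Proof.
apply/rowP => q.
by rewrite mul_gramT mxE -hmul_deltal (integral_L _).1 hpairZr lam_L mulr1 hpair_delta.
Qed.

Lemma L_gram : L *m gram = eps.
Proof.
apply: hpair_ext => h.
by rewrite gramE (integral_L _).2 hpairZr lam_L mulr1.
Qed.

(* [S(h) = L_1 lambda(h L_2)] *)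
Lemma antip_gram : antip = gram *m (comul L)^T.
Proof.
apply: eq_mx_rV => h; rewrite mulmxA gram_comul L_gramT.
by rewrite counitr.
Qed.

(* [h = S(L_1) lambda(L_2 h)] *)
Lemma gramT_antip : gram^T *m (comul L)^T *m antip = 1%:M.
Proof.
by apply: eq_mx_rV => x; rewrite !mulmxA -gram_comul L_gram counitr // mulmx1.
Qed.

Hypothesis lam_trace : forall x y, hpair lam (hmul H x y) = hpair lam (hmul H y x).

Lemma gram_sym : gram^T = gram.
Proof.
apply: eq_mx_rV => x; apply: hpair_ext => y.
by rewrite gramE hpair_mulmx trmxK hpairC gramE.
Qed.

(** For a symmetric Gram matrix the left factor in [gramT_antip] is the Frobenius expression of the
    antipode. *)
Lemma antipK : antip *m antip = 1%:M.
Proof. by rewrite {1}antip_gram -{1}gram_sym gramT_antip. Qed.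

(** [S(xy) = L_1 lambda(x y L_2) = S(y) L_1 lambda(x L_2) = S(y) S(x)]. *)
Lemma antip_hmul x y :
  hmul H x y *m antip = hmul H (y *m antip) (x *m antip).
Proof.
rewrite {1}antip_gram mulmxA mul_gram lmulM // trmx_mul !mulmxA -mul_gram.
by rewrite -!mulmxA -trmx_mul -L_comul trmx_mul trmxK !mulmxA -(mulmxA x) -antip_gram hmul_lmul.
Qed.

Lemma antip_one : one *m antip = one.
Proof.
rewrite -[LHS](mulh1 HH) -[X in hmul H _ X]mulmx1 -antipK mulmxA -antip_hmul.
by rewrite mulh1 // -mulmxA antipK mulmx1.
Qed.

(** Apply [p] to the first factor and write [S(h) = L_1 lambda(h L_2)]: coassociativity moves [p]
    into [L], and [gram_comul] with [x = L <- p] moves the coproduct to [h]. *)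
Lemma comul_antip h : comul (h *m antip) = antip^T *m (comul h)^T *m antip.
Proof.
apply: eq_mx_rV => p; rewrite {1}antip_gram mulmxA -hlharp_comul hlharp_act.
rewrite -mulmxA comul_act // gram_comul !mulmxA; do 2!congr (_ *m _).
by rewrite antip_gram trmx_mul trmxK mulmxA.
Qed.

Lemma dmul_antip p q :
  dmul H p q *m antip^T = dmul H (q *m antip^T) (p *m antip^T).
Proof.
apply: hpair_ext => h; rewrite hpair_mulmx trmxK !hpair_dmul comul_antip.
by rewrite [RHS]hpairC !hpair_mulmx trmxK !mulmxA.
Qed.

(* Since [S^2 = 1], [h = L_1 lambda(S(h) L_2)], so the operator [h |-> p(h_1) h_2]
   has trace [p(L_1) lambda(S(L_2) L_3)]. *)
Lemma mxtrace_act p : \tr (act p) = hpair p L * hpair lam one.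
Proof.
have -> : \tr (act p) = \tr ((comul (p *m comul L))^T *m (antip *m gram)).
  rewrite -[act p]mul1mx -antipK {2}antip_gram -!mulmxA comul_act //.
  by rewrite [in RHS]mxtrace_mulC -mulmxA.
have -> : hpair p L = hpair eps (p *m comul L).
  by rewrite [RHS]hpairC hpair_mulmx counitr.
(* The scalar [eps(L <- p)] is unfolded as [S(h_1) h_2] for [h = L <- p]. *)
rewrite -hpairZr -antipode_comul // /mxtrace.
under eq_bigr do rewrite mxE.
rewrite exchange_big [RHS]hpair_sumr; apply: eq_bigr => a _ /=.
rewrite hpair_sumr; apply: eq_bigr => b _; rewrite hpairZr mxE; congr (_ * _).
rewrite -hmul_rmul -gramE hpair_delta !mxE.
by apply: eq_bigr => c _; rewrite !mxE.
Qed.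

Hypothesis d_gt0 : (0 < d)%N.
Hypothesis lam_one : hpair lam one = d%:R.

(** The trace formula at [p = eps], where [act p] is the identity, of trace [d]. *)
Lemma eps_L : hpair eps L = 1.
Proof.
have d0 : d%:R != 0 :> C by rewrite pnatr_eq0 -lt0n.
apply: (mulIf d0); rewrite mul1r -{1}lam_one -mxtrace_act act_eps //.
by rewrite mxtrace1.
Qed.

(* The coefficients of the Casimir element [L_1 (x) S(L_2)]. *)
Definition casimir_mx : 'M[C]_d := comul L *m antip.

Lemma lmul_antip h : lmul (h *m antip) *m antip = antip *m rmul h.
Proof.
apply: eq_mx_rV => x; rewrite !mulmxA -hmul_lmul antip_hmul.
by rewrite -mulmxA antipK mulmx1 hmul_rmul.
Qed.

(** Apply [L_comul] to [S(h)]: [h L_1 (x) S(L_2) = L_1 (x) S(S(h) L_2) = L_1 (x) S(L_2) h]. *)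
Lemma casimir_mx_comm h : (lmul h)^T *m casimir_mx = casimir_mx *m rmul h.
Proof.
rewrite -{1}[h]mulmx1 -antipK !mulmxA L_comul -!mulmxA; congr (_ *m _).
exact: lmul_antip.
Qed.

(** [S(L_2) L_1 = S(S(L_1) L_2) = eps(L) S(1) = 1]. *)
Lemma casimir_mx_flip :
  \sum_a \sum_b casimir_mx a b *: hmul H (delta_mx 0 b) (delta_mx 0 a) = one.
Proof.
transitivity (\sum_a (hmul H (row a casimir_mx) (delta_mx 0 a))).
  apply: eq_bigr => a _; rewrite hmul_rmul mulmx_sum_row.
  by apply: eq_bigr => b _; rewrite hmul_rmul -rowE; congr (_ *: _); rewrite [RHS]mxE.
rewrite -[RHS](antip_one) -[X in X *m antip]scale1r -eps_L -antipode_comul // mulmx_suml.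
apply: eq_bigr => a _; rewrite mulmx_suml.
transitivity (hmul H (row a (comul L) *m antip) (row a antip *m antip)).
  by rewrite -!row_mul antipK row1.
rewrite -antip_hmul hmul_lmul [X in X *m _]mulmx_sum_row mulmx_suml.
apply: eq_bigr => b _; rewrite -!scalemxAl mxE; congr (_ *: (_ *m _)).
by rewrite rowE -hmul_lmul hmul_rmul.
Qed.

End Integrals.

(** * Characters *)

Lemma mxtrace_tens (K : comNzRingType) r s (A : 'M[K]_r) (B : 'M[K]_s) :
  \tr (A *t B) = \tr A * \tr B.
Proof. by rewrite /mxtrace mulr_sum; apply: eq_bigr => i _; rewrite mxE. Qed.

Lemma tensmx11 (K : comNzRingType) r s :
  (1%:M : 'M[K]_r) *t (1%:M : 'M[K]_s) = 1%:M.
Proof.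
apply/matrixP => i j; rewrite !mxE -natrM mulnb; congr (nat_of_bool _)%:R.
by rewrite -[RHS](can_eq (@mxtens_unindexK _ _)).
Qed.

Lemma tensmx_suml (K : comNzRingType) I (l : seq I) r s F (B : 'M[K]_s) :
  (\sum_(i <- l) F i) *t B = \sum_(i <- l) ((F i : 'M[K]_r) *t B).
Proof.
apply/matrixP => i j; rewrite mxE !summxE mulr_suml.
by apply: eq_bigr => k _; rewrite mxE.
Qed.

Lemma tensmxZl (K : comNzRingType) r s c (A : 'M[K]_r) (B : 'M[K]_s) :
  (c *: A) *t B = c *: (A *t B).
Proof. by apply/matrixP => i j; rewrite !mxE mulrA. Qed.

Lemma tensmxZr (K : comNzRingType) r s c (A : 'M[K]_r) (B : 'M[K]_s) :
  A *t (c *: B) = c *: (A *t B).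
Proof. by apply/matrixP => i j; rewrite !mxE mulrCA. Qed.

Lemma tensmx_sumr (K : comNzRingType) I (l : seq I) r s F (A : 'M[K]_r) :
  A *t (\sum_(i <- l) F i) = \sum_(i <- l) (A *t (F i : 'M[K]_s)).
Proof.
apply/matrixP => i j; rewrite mxE !summxE mulr_sumr.
by apply: eq_bigr => k _; rewrite mxE.
Qed.

(** * Representations and their tensor products *)

Section Representations.
Variables (R : realType) (d : nat) (H : hopf_data R d).
Local Notation C := R[i].
Local Notation comul := (lcomb (comulb H)).
Local Notation one := (hone H).
Local Notation antip := (antip H).
Hypothesis HH : is_hopf_algebra H.

Lemma row_lmulb a b : row b (lmulb H a) = \row_c hmu H a b c.
Proof. by apply/rowP => c; rewrite !mxE. Qed.

Lemma is_repP r (rho : 'I_d -> 'M[C]_r) :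
  is_rep H rho <->
  (forall a b, rho a *m rho b = lcomb rho (row b (lmulb H a))) /\
  lcomb rho one = 1%:M.
Proof.
have E a b : \sum_c hmu H a b c *: rho c = lcomb rho (row b (lmulb H a)).
  by rewrite lcomb_sum row_lmulb; apply: eq_bigr => c _; rewrite mxE.
rewrite lcomb_sum; split=> -[rhoM rho1]; split=> // a b; rewrite rhoM ?E //.
Qed.

Section OneRep.
Variables (r : nat) (rho : 'I_d -> 'M[C]_r).
Hypothesis rep_rho : is_rep H rho.

Lemma rep_mul a h : rho a *m lcomb rho h = lcomb rho (h *m lmulb H a).
Proof.
have [rhoM _] := (is_repP rho).1 rep_rho.
rewrite [in LHS]lcomb_sum mulmx_sumr lcomb_mulmx; apply: eq_bigr => b _.
by rewrite -scalemxAr rhoM.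
Qed.

Lemma repM x y : lcomb rho (hmul H x y) = lcomb rho x *m lcomb rho y.
Proof.
rewrite hmul_rmul lcomb_mulmx [X in X *m _]lcomb_sum mulmx_suml.
apply: eq_bigr => a _; rewrite -scalemxAl rep_mul; congr (_ *: lcomb _ _).
by rewrite rowE -hmul_rmul hmul_deltal.
Qed.

Lemma rep1 : lcomb rho one = 1%:M.
Proof. by have [] := (is_repP rho).1 rep_rho. Qed.

Lemma hpair_character h : hpair (character rho) h = \tr (lcomb rho h).
Proof.
rewrite lcomb_sum linear_sum; apply: eq_bigr => a _ /=.
by rewrite mxtraceZ mxE mulrC.
Qed.

Lemma character_trace x y :
  hpair (character rho) (hmul H x y) = hpair (character rho) (hmul H y x).
Proof. by rewrite !hpair_character !repM mxtrace_mulC. Qed.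

End OneRep.

Section Tensor.
Variables (r s : nat) (rho : 'I_d -> 'M[C]_r) (sigma : 'I_d -> 'M[C]_s).
Hypotheses (rep_rho : is_rep H rho) (rep_sigma : is_rep H sigma).

(* [rho (x) sigma] evaluated at the tensor with coefficient matrix [M]. *)
Definition tens_eval (M : 'M[C]_d) : 'M[C]_(r * s) :=
  \sum_a rho a *t lcomb sigma (row a M).

Lemma tens_eval_is_linear : linear tens_eval.
Proof.
move=> c M N; rewrite /tens_eval scaler_sumr -big_split; apply: eq_bigr => a _ /=.
by rewrite !linearP /=; apply/matrixP => i j; rewrite !mxE; ring.
Qed.
HB.instance Definition _ :=
  GRing.isLinear.Build C 'M[C]_d 'M[C]_(r * s) _ tens_eval tens_eval_is_linear.

Definition tens_rep c := tens_eval (comulb H c).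

Lemma tens_eval_mul p q M :
  (rho p *t sigma q) *m tens_eval M = tens_eval ((lmulb H p)^T *m M *m lmulb H q).
Proof.
have [rhoM _] := (is_repP rho).1 rep_rho.
rewrite mulmx_sumr.
transitivity (\sum_a \sum_x hmu H p a x *:
    (rho x *t lcomb sigma (row a (M *m lmulb H q)))).
  apply: eq_bigr => a _; rewrite tensmx_mul rep_mul // -row_mul rhoM.
  rewrite lcomb_sum tensmx_suml; apply: eq_bigr => x _ /=.
  by rewrite row_lmulb mxE tensmxZl.
rewrite exchange_big; apply: eq_bigr => x _ /=.
rewrite -mulmxA row_mul mulmx_sum_row linear_sum tensmx_sumr.
by apply: eq_bigr => a _; rewrite linearZ tensmxZr !mxE.
Qed.

Lemma tens_is_rep : is_rep H tens_rep.
Proof.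
apply/is_repP; split=> [a b|].
  transitivity (tens_eval (comul (delta_mx 0 b *m lmulb H a))).
    rewrite {1}/tens_rep {1}/tens_eval mulmx_suml comul_lmulb // lcomb_delta.
    rewrite [RHS]linear_sum; apply: eq_bigr => p _ /=.
    rewrite lcomb_sum tensmx_sumr mulmx_suml [RHS]linear_sum; apply: eq_bigr => q _ /=.
    rewrite tensmxZr -scalemxAl tens_eval_mul [RHS]linearZ /=.
    by rewrite !mxE.
  rewrite -rowE !lcomb_sum linear_sum; apply: eq_bigr => c _ /=.
  by rewrite linearZ.
have comul1 : comul one = one^T *m one.
  have [_ [_ [_ [_ [_ [_ [D1 _]]]]]]] := HH.
  apply/matrixP => x y; rewrite lcombE !mxE big_ord1 !mxE -D1.
  by apply: eq_bigr => a _; rewrite mxE.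
transitivity (tens_eval (comul one)).
  by rewrite !lcomb_sum linear_sum; apply: eq_bigr => c _; rewrite linearZ.
rewrite comul1 /tens_eval.
transitivity (lcomb rho one *t lcomb sigma one).
  rewrite [in RHS](lcomb_sum rho) tensmx_suml; apply: eq_bigr => a _ /=.
  rewrite row_mul mulmx_sum_row big_ord1 !mxE linearZ tensmxZr tensmxZl /=.
  by congr (_ *: (_ *t lcomb _ _)); apply/rowP => c; rewrite !mxE.
by rewrite !rep1 // tensmx11.
Qed.

Lemma character_tens : character tens_rep = dmul H (character rho) (character sigma).
Proof.
apply/rowP => c; rewrite !mxE linear_sum; apply: eq_bigr => a _ /=.
rewrite mxtrace_tens -hpair_character mulr_sumr; apply: eq_bigr => b _.
by rewrite !mxE mulrA.
Qed.

End Tensor.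
End Representations.

(** * Dual representations, composition factors and Schur's lemma *)

Section Irreducible.
Variables (R : realType) (d : nat) (H : hopf_data R d).
Local Notation C := R[i].
Local Notation one := (hone H).
Local Notation antip := (antip H).

Definition dual_rep r (rho : 'I_d -> 'M[C]_r) a : 'M[C]_r :=
  (lcomb rho (row a antip))^T.

Lemma dual_is_rep r (rho : 'I_d -> 'M[C]_r) :
  is_hopf_algebra H ->
  (forall x y, hmul H x y *m antip = hmul H (y *m antip) (x *m antip)) ->
  one *m antip = one -> is_rep H rho -> is_rep H (dual_rep rho).
Proof.
move=> HH SM S1 rep_rho.
have E h : lcomb (dual_rep rho) h = (lcomb rho (h *m antip))^T.
  rewrite lcomb_mulmx lcomb_sum linear_sum; apply: eq_bigr => a _.
  by rewrite linearZ.
apply/is_repP; split=> [a b|]; last by rewrite E S1 rep1 // trmx1.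
rewrite E -trmx_mul -(repM rep_rho) ![in LHS]rowE -SM.
by rewrite hmul_deltal -rowE.
Qed.

Lemma character_dual r (rho : 'I_d -> 'M[C]_r) :
  character (dual_rep rho) = character rho *m antip^T.
Proof.
apply/rowP => a; rewrite !mxE mxtrace_tr lcomb_sum linear_sum.
by apply: eq_bigr => b _; rewrite /= mxtraceZ !mxE mulrC.
Qed.

Lemma intertwiner_lcomb r s (rho : 'I_d -> 'M[C]_r) (sigma : 'I_d -> 'M[C]_s)
    (B : 'M[C]_(s, r)) h :
  (forall a, B *m (rho a)^T = (sigma a)^T *m B) ->
  B *m (lcomb rho h)^T = (lcomb sigma h)^T *m B.
Proof.
move=> rB; rewrite !lcomb_sum !(raddf_sum (@trmx C _ _)) mulmx_sumr mulmx_suml.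
by apply: eq_bigr => a _; rewrite /= !linearZ /= -scalemxAl rB.
Qed.

(** Transposes turn column modules into row spaces: an injective [B] embeds [sigma] in [rho], and
    cancelling [B] transfers the identities of [rho]. *)
Lemma intertwiner_sub r s (rho : 'I_d -> 'M[C]_r) (sigma : 'I_d -> 'M[C]_s)
    (B : 'M[C]_(s, r)) :
  is_rep H rho -> row_free B ->
  (forall a, B *m (rho a)^T = (sigma a)^T *m B) -> is_rep H sigma.
Proof.
move=> /is_repP[rhoM rho1] fB rB; apply/is_repP; split=> [a b|].
  apply: trmx_inj; apply: (row_free_inj fB) => /=.
  by rewrite -(intertwiner_lcomb _ rB) trmx_mul -mulmxA -rB mulmxA -rB -mulmxA -trmx_mul rhoM.
apply: trmx_inj; apply: (row_free_inj fB) => /=.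
by rewrite -(intertwiner_lcomb _ rB) rho1 !trmx1 mulmx1 mul1mx.
Qed.

Lemma intertwiner_quo r s (rho : 'I_d -> 'M[C]_r) (sigma : 'I_d -> 'M[C]_s)
    (K : 'M[C]_(r, s)) :
  is_rep H rho -> row_full K ->
  (forall a, K *m (sigma a)^T = (rho a)^T *m K) -> is_rep H sigma.
Proof.
move=> /is_repP[rhoM rho1] fK rK; apply/is_repP; split=> [a b|].
  apply: trmx_inj; apply: (row_full_inj fK) => /=.
  by rewrite (intertwiner_lcomb _ rK) trmx_mul mulmxA rK -mulmxA rK mulmxA -trmx_mul rhoM.
apply: trmx_inj; apply: (row_full_inj fK) => /=.
by rewrite (intertwiner_lcomb _ rK) rho1 !trmx1 mulmx1 mul1mx.
Qed.

(** [sigma] acts on [U] and [tau] on the quotient by [U]; characters add along this exact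
    sequence. *)
Lemma invariant_split r (rho : 'I_d -> 'M[C]_r) (U : 'M[C]_r) :
  is_rep H rho -> (forall a, stablemx U (rho a)^T) -> U != 0 -> ~~ row_full U ->
  exists s t (sigma : 'I_d -> 'M[C]_s) (tau : 'I_d -> 'M[C]_t),
    [/\ (s < r)%N, (t < r)%N, is_rep H sigma, is_rep H tau &
        character rho = character sigma + character tau].
Proof.
move=> rep_rho stU U0 nfU.
pose s := \rank U; pose t := \rank (cokermx U).
have [B fB [UB BU]] : exists2 B : 'M[C]_(s, r), row_free B & (U <= B)%MS /\ (B <= U)%MS.
  by exists (row_base U); [exact: row_base_free | rewrite !eq_row_base].
have [K fK KU] : exists2 K : 'M[C]_(r, t), row_full K &
    forall m (v : 'M[C]_(m, r)), (v *m K == 0) = (v <= U)%MS.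
  exists (col_base (cokermx U)); first exact: col_base_full.
  move=> m v; rewrite submxE -[cokermx U in RHS]mulmx_base mulmxA.
  apply/eqP/eqP => [->|E]; first by rewrite mul0mx.
  by apply: (row_free_inj (row_base_free (cokermx U))); rewrite /= E mul0mx.
have /row_fullP[Kl KlK] := fK.
have stB a : (B *m (rho a)^T <= B)%MS.
  by apply: submx_trans UB; apply: submx_trans (stU a); exact: submxMr.
pose sigma a := (B *m (rho a)^T *m pinvmx B)^T.
pose tau a := (Kl *m (rho a)^T *m K)^T.
have sB a : B *m (rho a)^T = (sigma a)^T *m B by rewrite trmxK mulmxKpV.
have BK : B *m K = 0 by apply/eqP; rewrite KU.
(* [Q] projects onto [U], the kernel of [K], along the row space of [Kl]; the trace of [rho a]
   splits along [1 = Q + K Kl]. *)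
pose Q := 1%:M - K *m Kl.
have QB : Q *m pinvmx B *m B = Q.
  apply: mulmxKpV; apply: submx_trans UB; rewrite -KU mulmxBl mul1mx -mulmxA KlK.
  by rewrite mulmx1 subrr.
have tK a : K *m (tau a)^T = (rho a)^T *m K.
  apply/esym; rewrite trmxK; apply/eqP; rewrite -subr_eq0 !mulmxA -mulmxBl -[X in X - _]mul1mx -mulmxBl -/Q.
  by rewrite -QB -!mulmxA (mulmxA B) sB -mulmxA BK !mulmx0.
exists s, t, sigma, tau; split.
- by rewrite ltn_neqAle rank_leq_row andbT.
- by rewrite /t mxrank_coker -subn_gt0 subKn ?rank_leq_row // lt0n mxrank_eq0.
- exact: intertwiner_sub sB.
- exact: intertwiner_quo tK.
have trQ a : \tr (Q *m (rho a)^T) = \tr (sigma a).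
  rewrite -{1}QB -mulmxA sB mulmxA mxtrace_mulC -[in RHS]mxtrace_tr (mulmxA B) (mulmxA B Q).
  have -> : B *m Q = B by rewrite mulmxBr mulmx1 mulmxA BK mul0mx subr0.
  by rewrite mulmxVp // mul1mx.
have trK a : \tr (K *m Kl *m (rho a)^T) = \tr (tau a).
  by rewrite -mulmxA mxtrace_mulC mxtrace_tr.
apply/rowP => a; rewrite !mxE -trQ -trK -mxtraceD -mulmxDl subrK mul1mx.
by rewrite mxtrace_tr.
Qed.

(** Induction on the dimension, splitting along an invariant subspace until irreducible or of
    dimension 0. The coefficients are natural numbers, which later gives real structure
    constants. *)
Lemma character_decomposition n (chi : 'I_n -> 'rV[C]_d) r (rho : 'I_d -> 'M[C]_r) :
  (forall p, irr_character H p -> exists k, p = chi k) -> is_rep H rho ->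
  exists m : 'I_n -> nat, character rho = \sum_k (m k)%:R *: chi k.
Proof.
move=> irr_chi; have [N] := ubnP r; elim: N r rho => // N IH r rho.
rewrite ltnS => rN rep_rho.
have [r0|r_gt0] := posnP r.
  exists (fun=> 0%N); rewrite big1 => [|k _]; last by rewrite scale0r.
  by apply/rowP => a; rewrite !mxE; move: (rho a); rewrite r0 => A; rewrite [A]flatmx0 mxtrace0.
have [irr|] := pselect (irr_rep H rho).
  have [|k ->] := irr_chi (character rho); first by exists r, rho.
  exists (fun l => (l == k) : nat); rewrite (bigD1 k) //= eqxx scale1r big1 ?addr0 // => l /negPf ->.
  by rewrite scale0r.
move=> nirr; have [U [stU U0 nfU]] : exists U : 'M[C]_r,
    [/\ forall a, stablemx U (rho a)^T, U != 0 & ~~ row_full U].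
  apply: contrapT => nU; apply: nirr; split=> // U stU; apply: contrapT => nUU.
  apply: nU; exists U; split=> //; apply/negP => E; apply: nUU; rewrite E ?orbT //.
have [s [t [sigma [tau [sr tr rs rt ->]]]]] := invariant_split rep_rho stU U0 nfU.
have [m1 ->] := IH s sigma (leq_trans sr rN) rs.
have [m2 ->] := IH t tau (leq_trans tr rN) rt.
exists (fun k => (m1 k + m2 k)%N); rewrite -big_split; apply: eq_bigr => k _ /=.
by rewrite natrD scalerDl.
Qed.

Lemma schur_bijective r s (rho : 'I_d -> 'M[C]_r) (sigma : 'I_d -> 'M[C]_s) (M : 'M[C]_(r, s)) :
  irr_rep H rho -> irr_rep H sigma -> (forall a, rho a *m M = M *m sigma a) ->
  M != 0 -> row_free M^T && row_full M^T.
Proof.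
move=> [_ _ irr_r] [_ _ irr_s] MM M0.
have MT a : M^T *m (rho a)^T = (sigma a)^T *m M^T by rewrite -!trmx_mul MM.
have stK a : stablemx (kermx M^T) (sigma a)^T.
  by rewrite sub_kermx -mulmxA -MT mulmxA mulmx_ker mul0mx.
(* [irr_rep] tests square matrices, so [M^T] is replaced by a square matrix with the same row
   space. *)
have stI a : stablemx <<M^T>>%MS (rho a)^T.
  by rewrite !genmxE (eqmxMr _ (genmxE _)) MT submxMl.
apply/andP; split.
  have /orP[|] := irr_s _ stK; first by rewrite kermx_eq0.
  by rewrite -sub1mx sub_kermx mul1mx trmx_eq0 (negPf M0).
have /orP[|] := irr_r _ stI; last by rewrite -!sub1mx genmxE.
by rewrite -mxrank_eq0 genmxE mxrank_eq0 trmx_eq0 (negPf M0).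
Qed.

Lemma schur_character r s (rho : 'I_d -> 'M[C]_r) (sigma : 'I_d -> 'M[C]_s) (M : 'M[C]_(r, s)) :
  irr_rep H rho -> irr_rep H sigma -> (forall a, rho a *m M = M *m sigma a) ->
  M != 0 -> character rho = character sigma.
Proof.
move=> irr irs MM M0; have /andP[fr fu] := schur_bijective irr irs MM M0.
have rs : r = s.
  by apply/eqP; move: fr fu; rewrite /row_free /row_full => /eqP -> /eqP ->.
move: rho sigma M irr irs MM M0 fr fu; rewrite rs => rho sigma M irr irs MM M0 fr _.
have uM : M \in unitmx by rewrite -unitmx_tr -row_free_unit.
by apply/rowP => a; rewrite !mxE -[rho a](mulmxK uM) MM -mulmxA mxtrace_mulC mulmxKV.
Qed.

(** Subtracting an eigenvalue leaves a singular intertwiner, which must vanish. *)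
Lemma schur_scalar r (rho : 'I_d -> 'M[C]_r) (M : 'M[C]_r) :
  irr_rep H rho -> (forall a, rho a *m M = M *m rho a) -> exists c, M = c%:M.
Proof.
case: r rho M => [|r] rho M irr MM; first by case: irr.
have /closed_rootP[c] : size (char_poly M) != 1%N by rewrite size_char_poly.
rewrite -eigenvalue_root_char => /eigenvalueP[v vM v0]; exists c.
apply/eqP; rewrite -subr_eq0; apply/negP => /negP N0.
have NN a : rho a *m (M - c%:M) = (M - c%:M) *m rho a.
  by rewrite mulmxBr mulmxBl MM scalar_mxC.
have /andP[fr _] := schur_bijective irr irr NN N0.
have uN : M - c%:M \in unitmx by rewrite -unitmx_tr -row_free_unit.
case/eqP: v0; rewrite -[v](mulmxK uN) mulmxBr vM mul_mx_scalar subrr mul0mx //.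
Qed.

End Irreducible.

(** * Orthogonality of characters by averaging over a Casimir element [W] *)

Section Orthogonality.
Variables (R : realType) (d : nat) (H : hopf_data R d).
Local Notation C := R[i].
Local Notation one := (hone H).
Local Notation lmul := (lcomb (lmulb H)).
Local Notation rmul := (lcomb (rmulb H)).

Variable W : 'M[C]_d.
Hypothesis WC : forall h, (lmul h)^T *m W = W *m rmul h.
Hypothesis W1 :
  \sum_a \sum_b W a b *: hmul H (delta_mx 0 b) (delta_mx 0 a) = one.

Definition average r s (rho : 'I_d -> 'M[C]_r) (sigma : 'I_d -> 'M[C]_s)
    (X : 'M[C]_(r, s)) : 'M[C]_(r, s) :=
  \sum_a rho a *m X *m lcomb sigma (row a W).

Lemma average_comm r s (rho : 'I_d -> 'M[C]_r) (sigma : 'I_d -> 'M[C]_s) X c :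
  is_rep H rho -> is_rep H sigma ->
  rho c *m average rho sigma X = average rho sigma X *m sigma c.
Proof.
move=> rep_rho rep_sigma; have [rhoM _] := (is_repP H rho).1 rep_rho.
transitivity (\sum_x rho x *m X *m lcomb sigma (row x (W *m rmul (delta_mx 0 c)))).
  rewrite -WC lcomb_delta mulmx_sumr.
  transitivity (\sum_a \sum_x hmu H c a x *: (rho x *m X *m lcomb sigma (row a W))).
    apply: eq_bigr => a _; rewrite !mulmxA rhoM lcomb_sum !mulmx_suml.
    by apply: eq_bigr => x _; rewrite row_lmulb mxE !scalemxAl.
  rewrite exchange_big; apply: eq_bigr => x _ /=.
  rewrite row_mul mulmx_sum_row linear_sum mulmx_sumr; apply: eq_bigr => a _ /=.
  by rewrite linearZ /= -scalemxAr !mxE.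
rewrite mulmx_suml; apply: eq_bigr => a _; rewrite -[RHS]mulmxA; congr (_ *m _).
by rewrite row_mul -hmul_rmul repM // lcomb_delta.
Qed.

(** The [(i, j)] entry of [A E_ij B] is [A_ii B_jj], so the double sum is a product of traces. *)
Lemma sum_average r s (rho : 'I_d -> 'M[C]_r) (sigma : 'I_d -> 'M[C]_s) :
  \sum_i \sum_j average rho sigma (delta_mx i j) i j =
  hpair (character sigma) (character rho *m W).
Proof.
rewrite [X in hpair _ X]mulmx_sum_row hpair_sumr.
under eq_bigr do under eq_bigr do rewrite summxE.
under eq_bigr do rewrite exchange_big.
rewrite exchange_big; apply: eq_bigr => a _ /=.
rewrite hpairZr mxE hpair_character mulr_suml; apply: eq_bigr => i _.
rewrite mulr_sumr; apply: eq_bigr => j _.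
rewrite -mulmxA mxE (bigD1 i) //= big1 => [|k ki].
  rewrite addr0 mxE (bigD1 j) //= big1 => [|k kj]; first by rewrite mxE !eqxx mul1r addr0.
  by rewrite mxE (negPf kj) andbF mul0r.
by rewrite mxE big1 ?mulr0 // => l _; rewrite mxE (negPf ki) mul0r.
Qed.

Lemma mxtrace_average r (rho : 'I_d -> 'M[C]_r) X :
  is_rep H rho -> \tr (average rho rho X) = \tr X.
Proof.
move=> rep_rho; rewrite -[in RHS](mulmx1 X) -(rep1 rep_rho) -W1 !linear_sum.
apply: eq_bigr => a _ /=; rewrite -mulmxA mxtrace_mulC -mulmxA; congr (\tr (_ *m _)).
rewrite lcomb_sum mulmx_suml linear_sum; apply: eq_bigr => b _ /=.
by rewrite linearZ /= repM // !lcomb_delta -scalemxAl mxE.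
Qed.

Lemma character_orthogonality r s (rho : 'I_d -> 'M[C]_r) (sigma : 'I_d -> 'M[C]_s) :
  irr_rep H rho -> irr_rep H sigma ->
  hpair (character sigma) (character rho *m W) = (character rho == character sigma)%:R.
Proof.
move=> irr irs; have [rr r0 _] := irr; have [rs _ _] := irs.
have [eq_char|ne_char] := eqVneq.
  rewrite -eq_char -sum_average.
  (* The average is scalar by Schur's lemma; as averaging preserves the trace, the scalar is
     [tr E_ij / r]. *)
  have av i j : average rho rho (delta_mx i j) = ((i == j)%:R / r%:R)%:M.
    have [c cE] := schur_scalar irr (fun a => average_comm (delta_mx i j) a rr rr).
    have := mxtrace_average (delta_mx i j) rr; rewrite cE mxtrace_scalar => cr.
    congr _%:M; have r0' : r%:R != 0 :> C by rewrite pnatr_eq0 -lt0n.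
    apply: (mulIf r0'); rewrite divfK // mulr_natr cr /mxtrace (bigD1 i) //= big1 => [|k ki].
      by rewrite addr0 mxE eqxx.
    by rewrite mxE (negPf ki).
  transitivity (\sum_(i < r) (r%:R^-1 : C)).
    apply: eq_bigr => i _; rewrite (bigD1 i) //= big1 => [|j ji].
      by rewrite av mxE !eqxx mul1r addr0.
    by rewrite av mxE eq_sym (negPf ji) mulr0n.
  by rewrite sumr_const card_ord -[LHS]mulr_natr mulVf // pnatr_eq0 -lt0n.
rewrite -sum_average big1 // => i _; rewrite big1 // => j _.
have [->|av0] := eqVneq (average rho sigma (delta_mx i j)) 0; first by rewrite mxE.
case/eqP: ne_char; apply: schur_character irr irs _ av0 => a.
exact: average_comm.
Qed.

End Orthogonality.

(** * The character ring *)

Section CharacterRing.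
Variables (R : realType) (d : nat) (H : hopf_data R d.+1).
Local Notation C := R[i].
Local Notation one := (hone H).
Local Notation act := (lcomb (actb H)).
Local Notation antip := (antip H).
Variables (L lam : 'rV[C]_d.+1) (n : nat) (chi : 'I_n -> 'rV[C]_d.+1).
Hypothesis HH : is_hopf_algebra H.
Hypothesis integral_L : is_integral H L.
Hypothesis integral_lam : is_dual_integral H lam.
Hypothesis lam_L : hpair lam L = 1.
Hypothesis chi_inj : injective chi.
Hypothesis chi_irr : forall k, irr_character H (chi k).
Hypothesis irr_chi : forall p, irr_character H p -> exists k, p = chi k.
Hypothesis lam_RH : in_RH chi lam.
Hypothesis lam_one : hpair lam one = d.+1%:R.

Local Notation S p := (p *m antip^T).
Local Notation u := (fun k => act (chi k)).
Local Notation v := (fun k => act (S (chi k))).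

Lemma in_RHP p : in_RH chi p <-> exists a : 'I_n -> C, p = \sum_k a k *: chi k.
Proof.
split=> [/submxP[a ->]|[a ->]].
  by exists (fun k => a 0 k); rewrite mulmx_sum_row; apply: eq_bigr => k _; rewrite rowK.
apply/summx_sub => k _; apply: scalemx_sub.
by rewrite -(rowK chi k) row_sub.
Qed.

Lemma chi_trace k x y : hpair (chi k) (hmul H x y) = hpair (chi k) (hmul H y x).
Proof. by have [r [rho [[rep _ _] ->]]] := chi_irr k; exact: character_trace. Qed.

Lemma lam_trace x y : hpair lam (hmul H x y) = hpair lam (hmul H y x).
Proof.
have [a ->] := (in_RHP _).1 lam_RH.
rewrite hpairC [RHS]hpairC !hpair_sumr; apply: eq_bigr => k _.
by rewrite !hpairZr hpairC chi_trace hpairC.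
Qed.

Lemma ntr_act p : ntr (act p) = hpair p L.
Proof.
rewrite /ntr (mxtrace_act HH integral_L integral_lam lam_L lam_trace) lam_one.
by rewrite mulfK // pnatr_eq0.
Qed.

Let SK (p : 'rV[C]_d.+1) : S (S p) = p.
Proof.
rewrite -mulmxA -trmx_mul (antipK HH integral_L integral_lam lam_L lam_trace).
by rewrite trmx1 mulmx1.
Qed.

Let dmulS p q : S (dmul H p q) = dmul H (S q) (S p).
Proof. exact: (dmul_antip HH integral_L integral_lam lam_L). Qed.

Let W := casimir_mx H L.

Lemma chi_orthogonality k l : hpair (chi l) (chi k *m W) = (k == l)%:R.
Proof.
have [r [rho [irr E]]] := chi_irr k; have [s [sigma [irs E']]] := chi_irr l.
rewrite E E' (character_orthogonality _ _ irr irs) -?E -?E' ?(inj_eq chi_inj) //.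
  exact: (casimir_mx_comm HH integral_L integral_lam lam_L lam_trace).
exact: (casimir_mx_flip HH integral_L integral_lam lam_L lam_trace).
Qed.

(** The left side is [chi_k(L_1) chi_l(S(L_2))], the pairing computed by [W]. *)
Lemma ntr_chi k l : ntr (u k * v l) = (k == l)%:R.
Proof.
rewrite -[_ * _](actM HH) ntr_act hpair_dmul hpair_mulmx trmxK -mulmxA.
exact: chi_orthogonality.
Qed.

Lemma decomp_S k : exists m : 'I_n -> nat, S (chi k) = \sum_l (m l)%:R *: chi l.
Proof.
have [r [rho [[rep _ _] ->]]] := chi_irr k; rewrite -character_dual.
apply: (character_decomposition irr_chi); apply: dual_is_rep => //.
  exact: (antip_hmul HH integral_L integral_lam lam_L).
exact: (antip_one HH integral_L integral_lam lam_L lam_trace).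
Qed.

Lemma decomp_mul k l :
  exists m : 'I_n -> nat, dmul H (chi k) (chi l) = \sum_j (m j)%:R *: chi j.
Proof.
have [r [rho [[rep _ _] ->]]] := chi_irr k; have [s [sigma [[rep' _ _] ->]]] := chi_irr l.
rewrite -character_tens; apply: (character_decomposition irr_chi).
exact: tens_is_rep.
Qed.

Lemma act_sum (a : 'I_n -> C) (p : 'I_n -> 'rV[C]_d.+1) :
  act (\sum_k a k *: p k) = \sum_k a k *: act (p k).
Proof. by rewrite linear_sum; apply: eq_bigr => k _; rewrite linearZ. Qed.

Lemma inspan_act p : inspan u (act p) <-> in_RH chi p.
Proof.
split=> [[a E]|/in_RHP[a ->]]; last by exists a; exact: act_sum.
by apply/in_RHP; exists a; apply: (act_inj HH); rewrite act_sum.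
Qed.

Lemma inspan_actP x : inspan u x -> exists2 p, in_RH chi p & x = act p.
Proof.
move=> [a ->]; exists (\sum_k a k *: chi k); last by rewrite act_sum.
by apply/in_RHP; exists a.
Qed.

Lemma inspan_S k : inspan u (v k).
Proof. by have [m ->] := decomp_S k; apply/inspan_act/in_RHP; exists (fun l => (m l)%:R). Qed.

Lemma inspan_mul k l : inspan u (u k * u l).
Proof.
rewrite -[_ * _](actM HH); have [m ->] := decomp_mul k l.
by apply/inspan_act/in_RHP; exists (fun l => (m l)%:R).
Qed.

Lemma ntr_decomp (m : 'I_n -> nat) l :
  ntr (act (\sum_k (m k)%:R *: chi k) * v l) = (m l)%:R.
Proof.
rewrite act_sum mulr_suml ntr_sum (bigD1 l) //= big1 => [|k kl].
  by rewrite -scalerAl ntrZ ntr_chi eqxx mulr1 addr0.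
by rewrite -scalerAl ntrZ ntr_chi (negPf kl) mulr0.
Qed.

Lemma real_S k l : (ntr (v k * v l))^* = ntr (v k * v l).
Proof. by have [m ->] := decomp_S k; rewrite ntr_decomp conjC_nat. Qed.

Lemma real_mul k l j : (ntr (u k * u l * v j))^* = ntr (u k * u l * v j).
Proof.
by rewrite -[u k * _](actM HH); have [m ->] := decomp_mul k l; rewrite ntr_decomp conjC_nat.
Qed.

Lemma coord_RH p : inspan u (act p) -> p = \sum_k ntr (act p * v k) *: chi k.
Proof.
move=> sp; apply: (act_inj HH); rewrite act_sum {1}(coord_u ntr_chi sp) //.
Qed.

Lemma SE (a : 'I_n -> C) : S (\sum_k a k *: chi k) = \sum_k a k *: S (chi k).
Proof. by rewrite mulmx_suml; apply: eq_bigr => k _; rewrite scalemxAl. Qed.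

Lemma u_S k : u k = \sum_l ntr (v k * v l) *: v l.
Proof. by rewrite -act_sum -SE -coord_RH ?SK //; exact: inspan_S. Qed.

Lemma S_mul k l : v l * v k = \sum_j ntr (u k * u l * v j) *: v j.
Proof.
rewrite -act_sum -SE -[u k * u l](actM HH) -coord_RH; last first.
  by rewrite (actM HH); exact: inspan_mul.
by rewrite dmulS (actM HH).
Qed.

Lemma prim_central_act e : central_prim_idem H chi e -> prim_central u (act e).
Proof.
move=> [se ce ee e0 pe].
have actMr p q : act (dmul H p q) = act p * act q by exact: actM.
split; first exact/inspan_act.
- by move=> _ /inspan_actP[p sp ->]; rewrite -!actMr ce.
- by rewrite -actMr ee.
- by apply: contra_neq e0 => E; apply: (act_inj HH); rewrite E linear0.
move=> _ /inspan_actP[q sq ->] cq qq eq.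
have qe : act q * act e = act q by rewrite cq //; exact/inspan_act.
have cq' : central_RH H chi q.
  by move=> p sp; apply: (act_inj HH); rewrite !actMr cq //; exact/inspan_act.
have se' : in_RH chi (e - q).
  by apply: addmx_sub => //; rewrite eqmx_opp.
(* An idempotent [q] below [e] yields the orthogonal decomposition [e = q + (e - q)]. *)
have [||||||||q0|eq0] := pe q (e - q) => //.
- move=> p sp; apply: (act_inj HH); rewrite !actMr linearB /= mulrBl mulrBr.
  by rewrite (cq _ ((inspan_act p).2 sp)) -[act e * _]actMr ce // actMr.
- by apply: (act_inj HH); rewrite actMr.
- apply: (act_inj HH); rewrite actMr linearB /= mulrBl !mulrBr eq qe qq -actMr ee.
  by rewrite subrr subr0.
- apply: (act_inj HH); rewrite actMr linearB linear0 /= mulrBr qe qq subrr //.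
- by rewrite addrC subrK.
- by left; rewrite q0 linear0.
- by right; congr (act _); apply/esym/eqP; rewrite -subr_eq0 eq0.
Qed.

Lemma prim_act e : prim_idem H chi e -> prim u (act e).
Proof.
move=> [se ee e0 pe].
have actMr p q : act (dmul H p q) = act p * act q by exact: actM.
split; first exact/inspan_act.
- by rewrite -actMr ee.
- by apply: contra_neq e0 => E; apply: (act_inj HH); rewrite E linear0.
move=> _ /inspan_actP[q sq ->] qq eq qe.
have se' : in_RH chi (e - q).
  by apply: addmx_sub => //; rewrite eqmx_opp.
have [|||||||q0|eq0] := pe q (e - q) => //.
- by apply: (act_inj HH); rewrite actMr.
- apply: (act_inj HH); rewrite actMr linearB /= mulrBl !mulrBr eq qe qq -actMr ee.
  by rewrite subrr subr0.
- by apply: (act_inj HH); rewrite actMr linearB linear0 /= mulrBr qe qq subrr.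
- by apply: (act_inj HH); rewrite actMr linearB linear0 /= mulrBl eq qq subrr.
- by rewrite addrC subrK.
- by left; rewrite q0 linear0.
- by right; congr (act _); apply/esym/eqP; rewrite -subr_eq0 eq0.
Qed.

(** [act f] is idempotent, so its trace is its rank, which is that of left multiplication by [f] on
    [H^*]. *)
Lemma dim_fHsE f : idem H f -> (dim_fHs H f)%:R = d.+1%:R * ntr (act f).
Proof.
move=> ff; rewrite ntr_idem; last by rewrite -[_ * _](actM HH) ff.
rewrite mulrC divfK ?pnatr_eq0 // -mxrank_tr; congr (\rank _)%:R.
by apply/row_matrixP => a; rewrite rowK dmul_act // rowE.
Qed.

Lemma row_free_RH : row_free (RH chi).
Proof.
apply/row_freeP; exists (W *m (RH chi)^T); apply/matrixP => k l.
rewrite mulmxA mxE [RHS]mxE -chi_orthogonality /hpair; apply: eq_bigr => a _.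
by rewrite mulrC !mxE; congr (_ * _); apply: eq_bigr => b _; rewrite mxE.
Qed.

Lemma dim_fRHE f : in_RH chi f -> idem H f ->
  (dim_fRH H chi f)%:R = \sum_k ntr (act f * u k * v k).
Proof.
(* [P] is the matrix of left multiplication by [f] on [R(H)] in the basis [chi]; being idempotent,
   it has trace equal to its rank. *)
move=> sf ff; pose P := \matrix_(k, l) ntr (act f * u k * v l).
have PE : P *m RH chi = RH chi *m (act f)^T.
  apply/row_matrixP => k; rewrite !row_mul mulmx_sum_row !rowK -(dmul_act H).
  rewrite [RHS]coord_RH; last first.
    rewrite (actM HH); apply: (inspanM inspan_mul); first exact/inspan_act.
    exact: inspan_u.
  by apply: eq_bigr => l _; rewrite rowK !mxE (actM HH).
have PP : P *m P = P.
  apply: (row_free_inj row_free_RH) => /=.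
  by rewrite -mulmxA PE mulmxA PE -mulmxA -trmx_mul -(actM HH) ff.
transitivity (\tr P); last by apply: eq_bigr => k _; rewrite mxE.
rewrite mxtrace_idem // -(mxrankMfree _ row_free_RH) PE; congr (\rank _)%:R.
by apply/row_matrixP => k; rewrite row_mul !rowK (dmul_act H).
Qed.

Lemma eta_chi k e f :
  hpair (chi k) (eta H L e f) =
  d.+1%:R / (dim_fHs H f)%:R * ntr (act e * u k).
Proof.
rewrite -[act e * _](actM HH) ntr_act hpair_dmul /eta hlharp_comul hpairZr.
by rewrite -scalemxAl hpairZr mulrA [_^-1 * _]mulrC.
Qed.

(** By [eta_chi] this is the Gram relation for [e] and [g], rescaled. The hypothesis
    [e = g -> f = h] makes the two scaling factors agree in the diagonal case. *)
Lemma xi_orthogonality e g f h :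
  central_prim_idem H chi e -> central_prim_idem H chi g ->
  prim_idem H chi f -> prim_idem H chi h ->
  dmul H f e = f -> dmul H h g = h -> (e = g -> f = h) -> 
  \sum_k hpair (chi k) (eta H L e f) * (hpair (chi k) (eta H L g h))^* =
  (e == g)%:R * (d.+1%:R * (dim_fRH H chi f)%:R / (dim_fHs H f)%:R).
Proof.
move=> pe pg pf ph fe hg efh.
under eq_bigr do rewrite !eta_chi rmorphM /= mulrACA.
rewrite -mulr_sumr (prim_central_gram ntr_chi inspan_S inspan_mul real_S real_mul u_S S_mul);
  [|exact: prim_central_act|exact: prim_central_act].
rewrite (inj_eq (act_inj HH)); have [eg|_] := eqVneq e g; last by rewrite !mul0r mulr0.
have [sf ff f0 _] := pf.
rewrite !mul1r -(efh eg) (ntr_prim_central ntr_chi inspan_S inspan_mul _ (prim_act pf));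
  [|exact: prim_central_act|by rewrite -[_ * _](actM HH) fe].
rewrite -dim_fRHE // rmorphM fmorphV !rmorph_nat dim_fHsE //.
have t0 : ntr (act f) != 0.
  have [_ ff' f0' _] := prim_act pf.
  exact: ntr_idem_neq0.
have d0 : d.+1%:R != 0 :> C by rewrite pnatr_eq0.
move: (d.+1%:R : C) (ntr (act f)) d0 t0 => D t D0 t0.
by field; apply/andP.
Qed.

End CharacterRing.

Theorem theorem2p5 (R : realType) (d : nat) (H : hopf_data R d)
  (L lam : 'rV[R[i]]_d) (n m : nat)
  (chi : 'I_n -> 'rV[R[i]]_d) (F f : 'I_m -> 'rV[R[i]]_d) :
  is_hopf_algebra H -> semisimple H ->
  (* Lambda: the two-sided integral of H; lambda: the integral of H^*,
     normalized by <lambda, Lambda> = 1 *)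
  L != 0 -> is_integral H L -> is_dual_integral H lam -> hpair lam L = 1 ->
  (* chi_0 = eps, ..., chi_(n-1): the irreducible characters of H *)
  injective chi -> (forall k, irr_character H (chi k)) ->
  (forall p, irr_character H p -> exists k, p = chi k) ->
  (forall k : 'I_n, val k = 0%N -> chi k = heps H) ->
  (* F_0 = lambda / d, ..., F_(m-1): the central primitive idempotents of R(H) *)
  injective F -> (forall j, central_prim_idem H chi (F j)) ->
  (forall e, central_prim_idem H chi e -> exists j, e = F j) ->
  (forall j : 'I_m, val j = 0%N -> F j = (d%:R)^-1 *: lam) ->
  (* f_j: primitive idempotents of R(H) with f_j F_j = f_j *)
  (forall j, prim_idem H chi (f j)) -> (forall j, dmul H (f j) (F j) = f j) ->
  let xi := fun (k : 'I_n) (j : 'I_m) => hpair (chi k) (eta H L (F j) (f j)) in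
  forall i j : 'I_m,
    \sum_(k < n) xi k i * (xi k j)^* =
    (i == j)%:R * (d%:R * (dim_fRH H chi (f i))%:R / (dim_fHs H (f i))%:R).
Proof.
case: d H L lam chi F f => [|d] H L lam chi F f HH _ L0.
  (* In dimension 0 no [L] is nonzero. *)
  by case/eqP: L0; apply/rowP => -[].
move=> iL ilam lamL chi_inj chi_irr irr_chi _ F_inj primF _ F0 primf fF xi i j.
have d0 : d.+1%:R != 0 :> R[i] by rewrite pnatr_eq0.
(* The given index [i] shows that [m] is positive, so the index 0 exists. *)
pose i0 : 'I_m := Ordinal (leq_ltn_trans (leq0n i) (ltn_ord i)).
have F0E : F i0 = d.+1%:R^-1 *: lam by exact: F0.
have lamE : lam = d.+1%:R *: F i0 by rewrite F0E scalerA divff // scale1r.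
have [sF0 _ iF0 F00 _] := primF i0.
have lam_RH : in_RH chi lam by rewrite lamE; exact: scalemx_sub.
have lam_one : hpair lam (hone H) = d.+1%:R.
  (* As [lambda] is an integral, squaring [F_0 = lambda / d] multiplies it by [F_0(1)]; idempotence
     then forces [F_0(1) = 1]. *)
  have : hpair (F i0) (hone H) *: F i0 = F i0.
    rewrite -[RHS]iF0 [in RHS]F0E (dmul_act H) -scalemxAl -(dmul_act H).
    by rewrite -F0E (ilam _).1 F0E !scalerA mulrC.
  move/eqP; rewrite -subr_eq0 -[X in _ - X]scale1r -scalerBl scaler_eq0 (negPf F00) orbF.
  by rewrite subr_eq0 => /eqP E; rewrite lamE hpairZl E mulr1.
rewrite -(inj_eq F_inj).
apply: (xi_orthogonality HH iL ilam lamL) => //.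
by move/F_inj => ->.
Qed.
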